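(* Let $a,m$ be positive integers, $b$ a nonnegative integer, let $u$ be a real-valued $C^\infty$ function near the origin in $\mathbb{R}^2$ with $u(0,0)\ne0$, and let $\varepsilon_1,\dots,\varepsilon_m$ be real-valued $C^\infty$ functions defined near $0\in\mathbb{R}$ that are flat at $0$. Put $$G(x,y)=u(x,y)\,x^a\left(y^m+\varepsilon_1(x)y^{m-1}+\cdots+\varepsilon_m(x)\right).$$ Let $\phi$ be a $C^\infty$ function whose compact support is contained in a sufficiently small neighborhood of the origin (depending on $G$), and let $$\mathcal{Z}(s)=\int_{\mathbb{R}_+^2}|G(x,y)|^s\,x^b\,\phi(x,y)\,dx\,dy,$$ which is holomorphic on $\mathrm{Re}(s)>0$. Then $\mathcal{Z}(s)$ admits a meromorphic continuation to the region $\mathrm{Re}(s)>-1/m$. Furthermore, when $b>0$ and $m\ge a/b$, the poles of the extended $\mathcal{Z}(s)$ on $\mathrm{Re}(s)>-1/m$ are contained in the set $\{-(b+j)/a: j\in\mathbb{N}\}$.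
   Context: $\mathbb{R}_+$ denotes the set of nonnegative real numbers and $\mathbb{N}=\{1,2,\dots\}$. A $C^\infty$ function of one variable is flat at $0$ if all its derivatives (including the function itself) vanish at $0$. *)

(* Defs.v *)
From mathcomp Require Import all_boot all_order all_algebra.
From mathcomp Require Import all_classical all_reals all_analysis.
From mathcomp Require Import complex.

Set Implicit Arguments.
Unset Strict Implicit.
Unset Printing Implicit Defensive.

Import Order.TTheory GRing.Theory Num.Theory.
Import numFieldNormedType.Exports.

Local Open Scope classical_set_scope.
Local Open Scope ring_scope.
Local Open Scope complex_scope.

Section RealSmoothness.
Context {R : realType}.
Implicit Types (f : R * R -> R) (U : set (R * R)) (e : R -> R).

Definition axis (d : bool) : R * R := if d then (0, 1) else (1, 0).

(* The iterated partial derivative of f along the word ds: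
   false stands for d/dx and true for d/dy. *)
Definition partials (ds : seq bool) f : R * R -> R :=
  foldr (fun d g p => 'D_(axis d) g p) f ds.

(* Meaningful for open U, where partial derivatives at a point of U only
   depend on the values of f on U. *)
Definition smooth_on U f : Prop :=
  forall (ds : seq bool) (p : R * R), U p ->
    {for p, continuous (partials ds f)} /\
    (forall d : bool, derivable (partials ds f) p (axis d)).

Definition smooth_near_origin f : Prop :=
  exists U : set (R * R), [/\ open U, U (0, 0) & smooth_on U f].

Definition smooth_near0 e : Prop :=
  \forall x \near (0 : R), forall n : nat, derivable (derive1n n e) x 1.

Definition flat_at0 e : Prop := forall n : nat, derive1n n e 0 = 0.

End RealSmoothness.

Section ComplexAnalysis.
(* R[i] carries no topology of its own in the library: it gets one, together
   with its normed module structure over itself, as a numFieldType. Below, C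
   is always R[i]. *)
Context {C : numFieldType}.
Implicit Types (f g : C -> C) (D : set C) (z : C).

(* Derivability is taken over the field C, i.e. it is complex
   differentiability. *)
Definition holomorphic_at f z : Prop := \forall w \near z, derivable f w 1.

Definition holomorphic_on D f : Prop := forall z, D z -> holomorphic_at f z.

(* f has a pole of some order k > 0 at z; the value of f at z itself is
   irrelevant. *)
Definition pole f z : Prop :=
  exists (k : nat) (g : C -> C),
    [/\ (0 < k)%N, holomorphic_at g z, g z != 0 &
        \forall w \near z^', f w = g w / (w - z) ^+ k].

Definition meromorphic_on D f : Prop :=
  forall z, D z -> holomorphic_at f z \/ pole f z.

End ComplexAnalysis.

Section ComplexPower.
Context {R : realType}.

Definition halfplane (c : R) : set R[i] := [set s | c < complex.Re s].

(* t ^ s = exp (s ln t) for t > 0; for t = 0 the value is 0 as soon as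
   Re s is nonzero. *)
Definition cpowR (t : R) (s : R[i]) : R[i] :=
  (t `^ complex.Re s * cos (complex.Im s * ln t)) +i*
  (t `^ complex.Re s * sin (complex.Im s * ln t)).

End ComplexPower.

Section LocalZeta.
Context {R : realType}.

(* The Borel sigma-algebra used by lebesgue_measure is carried by
   measurableTypeR R; without this type ascription the product structure
   would be inferred from R itself, with another measure display. *)
Definition lebesgue2 :
    set (measurableTypeR R * measurableTypeR R) -> \bar R :=
  (@lebesgue_measure R \x @lebesgue_measure R)%E.

Definition cintegrable (A : set (R * R)) (F : R * R -> R[i]) : Prop :=
  lebesgue2.-integrable A (fun p => (complex.Re (F p))%:E) /\
  lebesgue2.-integrable A (fun p => (complex.Im (F p))%:E).

Definition cintegral (A : set (R * R)) (F : R * R -> R[i]) : R[i] :=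
  (\int[lebesgue2]_(p in A) complex.Re (F p)) +i*
  (\int[lebesgue2]_(p in A) complex.Im (F p)).

Definition quadrant : set (R * R) := [set p | 0 <= p.1 /\ 0 <= p.2].

(* A complex-valued C^oo function on the plane with compact support
   contained in U. *)
Definition test_function (U : set (R * R)) (phi : R * R -> R[i]) : Prop :=
  let supp := closure [set p | phi p != 0] in
  [/\ smooth_on setT (fun p => complex.Re (phi p)),
      smooth_on setT (fun p => complex.Im (phi p)),
      compact supp & supp `<=` U].

(* The index i : 'I_m stands for i + 1 in 1..m. *)
Definition modelG (a m : nat) (u : R * R -> R) (eps : 'I_m -> R -> R)
    (p : R * R) : R :=
  u p * p.1 ^+ a *
  (p.2 ^+ m + \sum_(i < m) eps i p.1 * p.2 ^+ (m - i.+1)).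

Definition zeta_integrand (G : R * R -> R) (b : nat) (phi : R * R -> R[i])
    (s : R[i]) (p : R * R) : R[i] :=
  cpowR `|G p| s * (p.1 ^+ b)%:C * phi p.

Definition zeta (G : R * R -> R) (b : nat) (phi : R * R -> R[i])
    (s : R[i]) : R[i] :=
  cintegral quadrant (zeta_integrand G b phi s).

End LocalZeta.

(* Main.v *)
Require Import Defs.
From mathcomp Require Import all_boot all_order all_algebra.
From mathcomp Require Import all_classical all_reals all_analysis.
From mathcomp Require Import complex.
From mathcomp Require Import measurable_realfun.
From mathcomp Require Import ring lra.

(** On the support of [phi] write [|G| = x^a |P| v] with [v = |u|] smooth and
    positive and [P = y^m + eps_1 y^(m-1) + ... + eps_m], and split
      Z(s) = J(s) + D(s),
      J(s) = integral of (x^a y^m v)^s x^b phi,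
      D(s) = integral of ((x^a |P| v)^s - (x^a y^m v)^s) x^b phi.
    Integrating by parts [a] times in [x] gives
      (a s + b + 1) ... (a s + b + a) J(s) = Q(s),
    where [Q] is made of absolutely convergent integrals on Re s > -1/m; this is
    where the only possible poles [-(b+j)/a] come from.  [D] converges and is
    holomorphic on Re s > -1/m: since the [eps_i] are flat, on [y > B x^M] the two
    powers differ by a factor [1 + O(x^a)], while on [y <= B x^M] each of them is
    integrable on its own, [M] being large in terms of [s].  The latter uses that
    the integral of [|P(x, .)|^t], [-1/m < t <= 0], over [[0, l]] is
    [O(l^(1 + m t))] uniformly in [x], which is seen by factoring [P(x, .)] over
    the complex numbers.

    Holomorphy of these integrals is read off Taylor expansions of [exp (s ln t)]
    in [s] with an integrable remainder.  A second order expansion makes the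
    difference quotient of [Q] derivable at a zero of the denominator, so the
    singularity there is either removable or a simple pole. *)

Import Order.TTheory GRing.Theory Num.Theory.
Import numFieldNormedType.Exports.
Local Open Scope classical_set_scope.
Local Open Scope ring_scope.
Local Open Scope complex_scope.
Set Implicit Arguments.
Unset Strict Implicit.
Unset Printing Implicit Defensive.

(** The zeros of [P(x, .)] move with [x] and need not depend smoothly on it, so [|P|^s] cannot be
    integrated by parts in [x] across them. Comparing with [y^m], which does not involve [x], moves
    the integration by parts to a power of a monomial times a positive smooth function. The number
    of steps is [a] because each one raises the power of [x] by one, and a factor [x^a] absorbs
    [x^(a Re s)] as long as [Re s > -1]; the gain [O(x^a)] asked of the comparison plays the same
    part. Nothing is integrated by parts in [y]: the edge [y = 0], where the test function may be
    nonzero, gives no boundary term, and the power [y^(m s)] left untouched is what confines the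
    argument to [Re s > -1/m]. As [Re s] approaches [-1/m], the gain [1 + m Re s] coming from the
    width of the flat region shrinks, so [M] must grow; flatness allows any [M]. Each [M] therefore
    serves only a strip around a given point, whereas [D] itself does not depend on [M]. *)

Local Notation Re := complex.Re.
Local Notation Im := complex.Im.

(** * Complex modulus and exponential *)

Section NearAt.
Context {C : numFieldType}.

(* [R[i]] has a topology only through its [numFieldType] structure, hence this
   wrapper. *)
Definition near_at (z : C) (P : C -> Prop) : Prop := \forall w \near z, P w.

Lemma near_atP (z : C) (P : C -> Prop) :
  near_at z P <-> exists2 e : C, 0 < e & forall w, `|w - z| < e -> P w.
Proof.
split=> [/nbhs_ballP[e /= e0 He]|[e e0 He]].
  by exists e => // w wz; apply: He; rewrite -ball_normE/= distrC.
by apply/nbhs_ballP; exists e => //= w; rewrite -ball_normE/= distrC => /He.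
Qed.

End NearAt.

Section ComplexModulus.
Context {R : realType}.
Implicit Types z w : R[i].

(** The norm of [R[i]] takes its values in [R[i]]; this is the same number read in [R], where it can
    be compared with real integrals. *)
Definition nrm z : R := Re `|z|.

Lemma normE z : `|z| = (nrm z)%:C.
Proof. by rewrite /nrm RRe_real ?normr_real. Qed.

Lemma nrm_ge0 z : 0 <= nrm z.
Proof. by rewrite -lecR -normE normr_ge0. Qed.

Lemma nrmM z w : nrm (z * w) = nrm z * nrm w.
Proof. by apply: complexI; rewrite rmorphM -!normE normrM. Qed.

Lemma nrmD z w : nrm (z + w) <= nrm z + nrm w.
Proof. by rewrite -lecR rmorphD/= -!normE ler_normD. Qed.

Lemma nrm0 : nrm 0 = 0.
Proof. by rewrite /nrm normr0. Qed.

Lemma nrm1 : nrm 1 = 1.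
Proof. by rewrite /nrm normr1. Qed.

Lemma nrm_eq0 z : (nrm z == 0) = (z == 0).
Proof. by rewrite -(inj_eq (@complexI R)) -normE normr_eq0. Qed.

Lemma nrm_gt0 z : (0 < nrm z) = (z != 0).
Proof. by rewrite lt_neqAle nrm_ge0 andbT eq_sym nrm_eq0. Qed.

Lemma nrmX z n : nrm (z ^+ n) = nrm z ^+ n.
Proof. by apply: complexI; rewrite rmorphXn/= -!normE normrX. Qed.

Lemma nrm_sqr z : nrm z ^+ 2 = Re z ^+ 2 + Im z ^+ 2.
Proof.
by rewrite /nrm normc_def /= sqr_sqrtr// addr_ge0// sqr_ge0.
Qed.

Lemma nrmC (x : R) : nrm x%:C = `|x|.
Proof. by rewrite /nrm normc_def /= expr0n addr0 sqrtr_sqr. Qed.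

Lemma nrm_real (x y : R) : nrm (x +i* y) ^+ 2 = x ^+ 2 + y ^+ 2.
Proof. by rewrite nrm_sqr. Qed.

Lemma Re_le_nrm z : `|Re z| <= nrm z.
Proof.
rewrite -(@ler_pXn2r _ 2)// ?nnegrE ?nrm_ge0//.
by rewrite nrm_sqr real_normK ?num_real// lerDl sqr_ge0.
Qed.

Lemma Im_le_nrm z : `|Im z| <= nrm z.
Proof.
rewrite -(@ler_pXn2r _ 2)// ?nnegrE ?nrm_ge0//.
by rewrite nrm_sqr real_normK ?num_real// lerDr sqr_ge0.
Qed.

Lemma nrm_le z : nrm z <= `|Re z| + `|Im z|.
Proof.
rewrite -(@ler_pXn2r _ 2)// ?nnegrE ?nrm_ge0// ?addr_ge0//.
rewrite nrm_sqr sqrrD !real_normK ?num_real//.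
by rewrite -addrA lerD2l lerDr mulrn_wge0// mulr_ge0.
Qed.

Lemma near_at_nrm z (P : R[i] -> Prop) :
  near_at z P <-> exists2 e : R, 0 < e & forall w, nrm (w - z) < e -> P w.
Proof.
rewrite near_atP; split=> [[e e0 He]|[e e0 He]].
  have eE : e = (Re e)%:C by rewrite RRe_real// gtr0_real.
  exists (Re e) => [|w wz]; first by rewrite -ltcR -eE.
  by apply: He; rewrite eE normE ltcR.
exists e%:C; first by rewrite ltcR.
by move=> w; rewrite normE ltcR => /He.
Qed.

Lemma ReM z w : Re (z * w) = Re z * Re w - Im z * Im w.
Proof. by case: z w => a b [c d]. Qed.
Lemma ImM z w : Im (z * w) = Re z * Im w + Im z * Re w.
Proof. by case: z w => a b [c d]. Qed.
Lemma ReD z w : Re (z + w) = Re z + Re w.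
Proof. by case: z w => a b [c d]. Qed.
Lemma ImD z w : Im (z + w) = Im z + Im w.
Proof. by case: z w => a b [c d]. Qed.
Lemma ReN z : Re (- z) = - Re z.
Proof. by case: z. Qed.
Lemma ImN z : Im (- z) = - Im z.
Proof. by case: z. Qed.

Lemma complexP z w : Re z = Re w -> Im z = Im w -> z = w.
Proof. by case: z w => a b [c d] /= -> ->. Qed.

Definition cexp z : R[i] :=
  (expR (Re z) * cos (Im z)) +i* (expR (Re z) * sin (Im z)).

Lemma cexpD z w : cexp (z + w) = cexp z * cexp w.
Proof.
by case: z w => a b [c d]; apply: complexP; rewrite /= expRD ?cosD ?sinD; ring.
Qed.

Lemma cexp0 : cexp 0 = 1.
Proof. by apply: complexP; rewrite /= expR0 ?cos0 ?sin0; ring. Qed.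

Lemma nrm_cexp z : nrm (cexp z) = expR (Re z).
Proof.
apply/eqP; rewrite -(@eqrXn2 _ 2)// ?nrm_ge0 ?expR_ge0//; apply/eqP.
by rewrite nrm_real !exprMn -mulrDr cos2Dsin2 mulr1.
Qed.

Definition cder (F : R -> R[i]) (F' : R[i]) (t : R) :=
  is_derive t 1 (fun x => Re (F x)) (Re F') /\
  is_derive t 1 (fun x => Im (F x)) (Im F').

Lemma cder_eq (F : R -> R[i]) (F' F'' : R[i]) (t : R) : cder F F' t -> F' = F'' -> cder F F'' t.
Proof. by move=> + <-. Qed.

Lemma cder_cst c (t : R) : cder (fun=> c) 0 t.
Proof. by split; exact: is_derive_cst. Qed.

Lemma cder_real (f : R -> R) (f' t : R) : is_derive t 1 f f' ->
  cder (fun x => (f x)%:C) f'%:C t.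
Proof. by move=> h; split => //=; exact: is_derive_cst. Qed.

Lemma cderD (F G : R -> R[i]) (F' G' : R[i]) (t : R) : cder F F' t -> cder G G' t ->
  cder (fun x => F x + G x) (F' + G') t.
Proof.
move=> [F1 F2] [G1 G2]; split.
  by under eq_fun do rewrite ReD; rewrite ReD; exact: is_deriveD.
by under eq_fun do rewrite ImD; rewrite ImD; exact: is_deriveD.
Qed.

Lemma cderM (F G : R -> R[i]) (F' G' : R[i]) (t : R) : cder F F' t -> cder G G' t ->
  cder (fun x => F x * G x) (F' * G t + F t * G') t.
Proof.
move=> [F1 F2] [G1 G2]; split.
  under eq_fun do rewrite ReM.
  apply: is_derive_eq; rewrite ReD !ReM /GRing.scale/=; ring.
under eq_fun do rewrite ImM.
apply: is_derive_eq; rewrite ImD !ImM /GRing.scale/=; ring.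
Qed.

Lemma cder_cexp (F : R -> R[i]) (F' : R[i]) (t : R) : cder F F' t ->
  cder (fun x => cexp (F x)) (F' * cexp (F t)) t.
Proof.
move=> [F1 F2]; split; rewrite /cexp/=.
  apply: is_derive_eq; rewrite ReM /GRing.scale/=; ring.
apply: is_derive_eq; rewrite ImM /GRing.scale/=; ring.
Qed.

(* The real mean value theorem is applied to the component of [F] in the
   direction of the increment. *)
Lemma ray_le (F F' : R -> R[i]) M :
  (forall t : R, 0 <= t <= 1 -> cder F (F' t) t) ->
  (forall t : R, 0 <= t <= 1 -> nrm (F' t) <= M) -> nrm (F 1 - F 0) <= M.
Proof.
move=> dF FM; set w := F 1 - F 0.
have [->|w0] := eqVneq w 0.
  by rewrite nrm0; apply: le_trans (FM 0 _); rewrite ?nrm_ge0// lexx ler01.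
pose g (x : R) := Re w * Re (F x) + Im w * Im (F x).
pose dg (x : R) := Re w * Re (F' x) + Im w * Im (F' x).
have gd (x : R) : 0 <= x <= 1 -> is_derive x 1 g (dg x).
  move=> /dF[F1 F2]; rewrite /g; apply: is_derive_eq.
  by rewrite /dg /GRing.scale/=; ring.
have [c c01 E] : exists2 c, c \in `[0, 1]%R & g 1 - g 0 = dg c * (1 - 0).
  apply: MVT_segment => //.
    by move=> x; rewrite in_itv/= => /andP[/ltW ? /ltW ?]; apply: gd; apply/andP.
  apply: derivable_within_continuous => x; rewrite in_itv/= => /gd H.
  exact: ex_derive.
have wM : nrm w ^+ 2 <= nrm w * M.
  rewrite nrm_sqr.
  have -> : Re w ^+ 2 + Im w ^+ 2 = g 1 - g 0.
    by rewrite /g {2 4}/w !ReD !ImD !ReN !ImN; ring.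
  rewrite E subr0 mulr1 /dg.
  have -> : Re w * Re (F' c) + Im w * Im (F' c) = Re (w^*%C * F' c).
    by case: (w) (F' c) => a b [a' b'] /=; ring.
  apply: le_trans (ler_norm _) _; apply: le_trans (Re_le_nrm _) _.
  rewrite nrmM; have -> : nrm w^* = nrm w by rewrite /nrm normcJ.
  by rewrite ler_wpM2l ?nrm_ge0// FM//; move: c01; rewrite in_itv.
by move: wM; rewrite expr2 ler_pM2l// nrm_gt0.
Qed.

Lemma cder_id (t : R) : cder (fun x => x%:C) 1 t.
Proof. by apply: cder_real; exact: is_derive_id. Qed.

Lemma nrmtM (t : R) z : 0 <= t <= 1 -> nrm (t%:C * z) <= nrm z.
Proof. by move=> /andP[t0 t1]; rewrite nrmM nrmC ger0_norm// ler_piMl ?nrm_ge0. Qed.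

Lemma cexp_ray_bound (t : R) z : 0 <= t <= 1 -> nrm (cexp (t%:C * z)) <= expR (nrm z).
Proof.
move=> t01; rewrite nrm_cexp ler_expR.
by apply: le_trans (ler_norm _) _; apply: le_trans (Re_le_nrm _) _; exact: nrmtM.
Qed.

Lemma cexp_sub1 z : nrm (cexp z - 1) <= nrm z * expR (nrm z).
Proof.
have := @ray_le (fun t => cexp (t%:C * z)) (fun t => z * cexp (t%:C * z))
  (nrm z * expR (nrm z)).
rewrite mul1r mul0r cexp0; apply => t t01.
  apply: cder_eq (cder_cexp (cderM (cder_id t) (cder_cst z t))) _; ring.
by rewrite nrmM ler_wpM2l ?nrm_ge0// cexp_ray_bound.
Qed.

Definition cexp_rem1 z := cexp z - 1 - z.
Definition cexp_rem2 z := cexp z - 1 - z - z ^+ 2 / 2.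

Lemma cderN (F : R -> R[i]) (F' : R[i]) (t : R) : cder F F' t ->
  cder (fun x => - F x) (- F') t.
Proof.
move=> dF; apply: (@cder_eq _ (0 * F t + -1 * F')); last by ring.
have := cderM (cder_cst (-1) t) dF.
by under eq_fun do rewrite mulN1r.
Qed.

Let cder_ray (t : R) z : cder (fun x => x%:C * z) z t.
Proof. by apply: cder_eq (cderM (cder_id t) (cder_cst z t)) _; ring. Qed.

(** Along the ray from 0 to [z] each Taylor remainder has derivative [z] times the previous
    remainder, so [ray_le] gains one power of [nrm z] at each order. The factorials are given
    away. *)
Lemma cexp_rem1_le z : nrm (cexp_rem1 z) <= nrm z ^+ 2 * expR (nrm z).
Proof.
have := @ray_le (fun t => cexp_rem1 (t%:C * z))
  (fun t => z * (cexp (t%:C * z) - 1)) (nrm z ^+ 2 * expR (nrm z)).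
rewrite /cexp_rem1 mul1r mul0r cexp0 !subrr !subr0; apply => t t01.
  apply: cder_eq (cderD (cderD (cder_cexp (cder_ray t z))
    (cder_cst (-1) t)) (cderN (cder_ray t z))) _; ring.
rewrite nrmM expr2 -mulrA ler_wpM2l ?nrm_ge0//.
apply: le_trans (cexp_sub1 _) _.
by rewrite ler_pM ?nrm_ge0 ?expR_ge0 ?nrmtM// ler_expR nrmtM.
Qed.

Lemma cexp_rem2_le z : nrm (cexp_rem2 z) <= nrm z ^+ 3 * expR (nrm z).
Proof.
have := @ray_le (fun t => cexp_rem2 (t%:C * z))
  (fun t => z * cexp_rem1 (t%:C * z)) (nrm z ^+ 3 * expR (nrm z)).
rewrite /cexp_rem2 mul1r mul0r cexp0 !subrr expr0n/= mul0r !subr0; apply => t t01.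
  under eq_fun do rewrite expr2.
  apply: cder_eq (cderD (cderD (cderD (cder_cexp (cder_ray t z))
    (cder_cst (-1) t)) (cderN (cder_ray t z)))
    (cderN (cderM (cderM (cder_ray t z) (cder_ray t z)) (cder_cst (2^-1) t)))) _.
  by rewrite /cexp_rem1; field.
rewrite nrmM exprS -mulrA ler_wpM2l ?nrm_ge0//.
apply: le_trans (cexp_rem1_le _) _.
by rewrite ler_pM ?exprn_ge0 ?nrm_ge0 ?expR_ge0// ?ler_expR ?nrmtM// lerXn2r ?nnegrE ?nrm_ge0 ?nrmtM.
Qed.

End ComplexModulus.

(** * Holomorphic functions and simple poles *)

Section Slope.
Context {C : numFieldType}.
Implicit Types (f g : C -> C) (z : C).

Definition cderivable f z : Prop := derivable f z 1.

(* The slope of [f] at [z], completed at [z], is derivable there.  This is all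
   that Riemann's removable singularity theorem needs, and it is stable under
   the algebraic operations. *)
Definition slope_derivable f z : Prop :=
  exists q : C -> C, (forall w, f w = f z + (w - z) * q w) /\ derivable q z 1.

Lemma derivable_mul f g z : derivable f z 1 -> derivable g z 1 ->
  derivable (fun w => f w * g w) z 1.
Proof. exact: derivableM. Qed.

Lemma derivable_add f g z : derivable f z 1 -> derivable g z 1 ->
  derivable (fun w => f w + g w) z 1.
Proof. exact: derivableD. Qed.

Lemma derivable_inv f z : f z != 0 -> derivable f z 1 ->
  derivable (fun w => (f w)^-1) z 1.
Proof. exact: derivableV. Qed.

Lemma derivable_subid z c : derivable (fun w : C => w - c) z 1.
Proof.
by apply: derivable_add; [exact: derivable_id|exact: derivable_cst].
Qed.

Lemma derivable_exp f z k : derivable f z 1 ->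
  derivable (fun w => f w ^+ k) z 1.
Proof.
move=> df; elim: k => [|k IH].
  by under eq_fun do rewrite expr0; exact: derivable_cst.
by under eq_fun do rewrite exprS; exact: derivable_mul.
Qed.

Lemma derivable_ccont f z : derivable f z 1 -> {for z, continuous f}.
Proof. by move/derivable1_diffP/differentiable_continuous. Qed.

Lemma slope_derivable_derivable f z : slope_derivable f z -> derivable f z 1.
Proof.
move=> [q [fE dq]]; rewrite (funext fE).
apply: derivable_add; first exact: derivable_cst.
by apply: derivable_mul; [exact: derivable_subid|exact: dq].
Qed.

Lemma slope_derivable_cst c z : slope_derivable (fun=> c) z.
Proof.
by exists (fun=> 0); split=> [w|]; [rewrite mulr0 addr0|exact: derivable_cst].
Qed.

Lemma slope_derivable_id z : slope_derivable id z.
Proof.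
by exists (fun=> 1); split=> [w|]; [rewrite mulr1/= addrC subrK|exact: derivable_cst].
Qed.

Lemma slope_derivableD f g z : slope_derivable f z -> slope_derivable g z ->
  slope_derivable (fun w => f w + g w) z.
Proof.
move=> [p [fE dp]] [q [gE dq]]; exists (fun w => p w + q w); split=> [w|].
  by rewrite fE gE; ring.
exact: derivable_add.
Qed.

Lemma slope_derivableM f g z : slope_derivable f z -> slope_derivable g z ->
  slope_derivable (fun w => f w * g w) z.
Proof.
move=> sf sg; have df := slope_derivable_derivable sf.
case: sf sg => [p [fE dp]] [q [gE dq]].
exists (fun w => f w * q w + p w * g z); split=> [w|].
  by rewrite [in LHS]gE mulrDr {1}fE; ring.
apply: derivable_add; first exact: derivable_mul.
by apply: derivable_mul; [exact: dp|exact: derivable_cst].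
Qed.

Lemma slope_derivable_prod (I : eqType) (s : seq I) (F : I -> C -> C) z :
  (forall i, i \in s -> slope_derivable (F i) z) ->
  slope_derivable (fun w => \prod_(i <- s) F i w) z.
Proof.
elim: s => [_|i s IH sF].
  by under eq_fun do rewrite big_nil; exact: slope_derivable_cst.
under eq_fun do rewrite big_cons; apply: slope_derivableM.
  by apply: sF; rewrite mem_head.
by apply: IH => j js; apply: sF; rewrite inE js orbT.
Qed.

Lemma near_neq f z : {for z, continuous f} -> f z != 0 ->
  \forall w \near z, f w != 0.
Proof.
move=> cf fz; apply: (cf [set x | x != 0]).
exists `|f z|; first by rewrite /= normr_gt0.
by move=> y /=; apply: contraTneq => ->; rewrite subr0 ltxx.
Qed.

(* [f] is not assumed invertible away from [z], hence the completion of the slope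
   by the value it would have anyway where [f] vanishes. *)
Lemma slope_derivableV f z : f z != 0 -> slope_derivable f z ->
  slope_derivable (fun w => (f w)^-1) z.
Proof.
move=> fz0 sf; have df := slope_derivable_derivable sf.
case: sf => [q [fE dq]].
pose p w := - (q w * (f w)^-1 * (f z)^-1).
have dp : derivable p z 1.
  rewrite /p; apply: derivableN; apply: derivable_mul; last exact: derivable_cst.
  by apply: derivable_mul; [exact: dq|exact: derivable_inv].
exists (fun w => if w == z then p w else ((f w)^-1 - (f z)^-1) / (w - z)); split.
  move=> w; case: eqVneq => [->|wz]; first by rewrite subrr mul0r addr0.
  by rewrite mulrC divfK ?subr_eq0// addrC subrK.
apply: near_eq_derivable dp.
have := near_neq (derivable_ccont df) fz0; apply: filterS => w fw0.
case: eqVneq => // wz; apply: (@mulIf _ (w - z)); rewrite ?subr_eq0//.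
rewrite divfK ?subr_eq0// /p.
have -> : (f w)^-1 - (f z)^-1 = (f z - f w) / (f w * f z).
  by field; rewrite fw0 fz0.
have -> : f z - f w = - ((w - z) * q w).
  by rewrite [f w]fE opprD addrA subrr add0r.
by field; rewrite fw0 fz0.
Qed.

Lemma derivable_taylor f z (c M r : C) : 0 < r ->
  (forall h : C, h != 0 -> `|h| < r -> `|f (z + h) - f z - h * c| <= M * `|h| ^+ 2) ->
  derivable f z 1.
Proof.
move=> r0 H; apply/cvg_ex; exists c; apply/cvgrPdist_le => e e0.
have [M0 Mge] : exists2 M' : C, 0 < M' & forall h : C, h != 0 -> `|h| < r ->
    `|f (z + h) - f z - h * c| <= M' * `|h| ^+ 2.
  exists (`|M| + 1) => [|h h0 hr]; first by rewrite ltr_wpDl.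
  have Mh : 0 <= M * `|h| ^+ 2 by apply: le_trans (H h h0 hr).
  (* In a general [numFieldType] the constant [M] need not be comparable with 0; the bound at a
     nonzero [h] forces it to be. *)
  have M0 : 0 <= M by move: Mh; rewrite pmulr_lge0// exprn_gt0// normr_gt0.
  apply: le_trans (H h h0 hr) _; rewrite (ger0_norm M0) mulrDl lerDl.
  by rewrite mul1r exprn_ge0.
move=> Mge'; near=> h.
have h0 : h != 0 by near: h; exact: nbhs_dnbhs_neq.
have hr : `|h| < r.
  near: h; apply: dnbhs0_lt => //.
rewrite distrC [h%:A]mulr1 (_ : h^-1 *: (f (h + z) - f z) - c = h^-1 * (f (z + h) - f z - h * c)); last first.
  by rewrite /GRing.scale/= (addrC h z); field.
rewrite normrM normfV ler_pdivrMl ?normr_gt0//.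
apply: le_trans (Mge' h h0 hr) _.
rewrite expr2 mulrA mulrC ler_pM2l ?normr_gt0//.
rewrite -ler_pdivlMl// ltW//.
near: h; apply: dnbhs0_lt; by rewrite mulr_gt0// invr_gt0.
Unshelve. all: by end_near. Qed.

(** Dividing the expansion by [h] yields the hypothesis of [derivable_taylor] for the slope
    completed by [c], with derivative [d]. Hence one order more is asked of [f] than for mere
    derivability. *)
Lemma slope_derivable_taylor f z (c d M r : C) : 0 < r ->
  (forall h : C, `|h| < r ->
     `|f (z + h) - f z - h * c - h ^+ 2 * d| <= M * `|h| ^+ 3) ->
  slope_derivable f z.
Proof.
move=> r0 H.
pose q w := if w == z then c else (f w - f z) / (w - z).
exists q; split.
  move=> w; rewrite /q; case: eqVneq => [->|wz]; first by rewrite subrr mul0r addr0.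
  by rewrite mulrC divfK ?subr_eq0// addrC subrK.
apply: (@derivable_taylor q z d M r) => // h h0 hr.
rewrite /q eqxx (_ : (z + h == z) = false); last first.
  by apply/negbTE; rewrite -subr_eq0 addrC addKr.
have hn : 0 < `|h| by rewrite normr_gt0.
rewrite -(ler_pM2l hn) -normrM.
have -> : h * ((f (z + h) - f z) / (z + h - z) - c - h * d) =
   f (z + h) - f z - h * c - h ^+ 2 * d by rewrite (addrC z h) addrK; field.
apply: le_trans (H h hr) _.
by rewrite (exprS _ 2) mulrCA.
Qed.

Lemma cderivable_near_eq f g z : near_at z (fun w => f w = g w) ->
  cderivable f z -> cderivable g z.
Proof. exact: near_eq_derivable. Qed.

Lemma open_near_at (D : set C) : (forall z, D z -> near_at z D) -> open D.
Proof. by move=> H; rewrite openE => z /H. Qed.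

Lemma holomorphic_near_at f z : near_at z (fun w => cderivable f w) ->
  holomorphic_at f z.
Proof. by []. Qed.

Lemma holomorphic_near_eq f g z : {near z, f =1 g} ->
  holomorphic_at f z -> holomorphic_at g z.
Proof.
move=> fg hf; have := nbhs_interior fg; move: hf; rewrite /holomorphic_at.
by apply: filterS2 => w dw fw; exact: near_eq_derivable dw.
Qed.

Lemma pole_near_eq f g z : (\forall w \near z^', f w = g w) ->
  pole f z -> pole g z.
Proof.
move=> fg [k [h [k0 hh hz H]]]; exists k, h; split=> //.
by apply: filterS2 fg H => w ->.
Qed.

(** If [f] is continuous at [z] then [f w * (w - z) ^+ k] tends to 0, but near [z] it equals [g w],
    which tends to [g z != 0]. *)
Lemma pole_not_holomorphic f z : pole f z -> ~ holomorphic_at f z.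
Proof.
move=> [k [g [k0 /nbhs_singleton hg gz H]]] /nbhs_singleton hf.
pose p w : C := (w - z) ^+ k.
have ck : {for z, continuous p}.
  apply: derivable_ccont.
  exact: (@derivable_exp (fun w => w - z) z k (@derivable_subid z z)).
have cf : f w @[w --> z^'] --> f z.
  by apply: cvg_within_filter; exact: (derivable_ccont hf).
have cg : g w @[w --> z^'] --> g z.
  by apply: cvg_within_filter; exact: (derivable_ccont hg).
have cp : (f w * p w) @[w --> z^'] --> f z * p z.
  apply: cvgM => //; apply: cvg_within_filter.
  exact: ck.
move: cp; rewrite {2}/p subrr expr0n gtn_eqF//= mulr0 => cp.
have : g w @[w --> z^'] --> 0.
  apply: cvg_trans cp; apply: near_eq_cvg.
  have nz : \forall w \near z^', w != z by exact: nbhs_dnbhs_neq.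
  apply: filterS2 nz H => w wz ->.
  by rewrite divfK// expf_neq0// subr_eq0.
by move=> g0; apply: (negP gz); apply/eqP; exact: (cvg_unique _ cg g0).
Qed.

Lemma near_dnbhs_if (P : C -> Prop) z : (\forall w \near z^', P w) -> P z ->
  \forall w \near z, P w.
Proof.
move=> H Pz; have H' : \forall w \near z, w != z -> P w by exact: H.
by apply: filterS H' => w Pw; have [->//|] := eqVneq w z.
Qed.

Section MeromorphicQuotient.
Variables (D : set C) (Q H : C -> C) (s : seq C).
Hypotheses (oD : open D) (us : uniq s).
Hypotheses (sQ : forall z, D z -> slope_derivable Q z).
Hypotheses (hH : forall z, D z -> derivable H z 1).

Let F w := Q w / \prod_(r <- s) (w - r) + H w.

Let prod_neq0 (t : seq C) z : z \notin t -> \prod_(r <- t) (z - r) != 0.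
Proof.
move=> zt; rewrite prodf_seq_neq0; apply/allP => r rt /=.
by rewrite subr_eq0; apply: contraNneq zt => ->.
Qed.

Let slope_quot (t : seq C) z : D z -> z \notin t ->
  slope_derivable (fun w => Q w / \prod_(r <- t) (w - r)) z.
Proof.
move=> Dz zt; apply: slope_derivableM; first exact: sQ.
apply: slope_derivableV; first exact: prod_neq0.
apply: slope_derivable_prod => r _.
apply: slope_derivableD; [exact: slope_derivable_id|exact: slope_derivable_cst].
Qed.

Let near_notin (t : seq C) z : z \notin t -> \forall w \near z, w \notin t.
Proof.
move=> zt; have : \forall w \near z, \prod_(r <- t) (w - r) != 0.
  apply: (@near_neq (fun w => \prod_(r <- t) (w - r))); last exact: prod_neq0.
  apply/derivable_ccont/slope_derivable_derivable.
  apply: slope_derivable_prod => r _.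
  apply: slope_derivableD; [exact: slope_derivable_id|exact: slope_derivable_cst].
apply: filterS => w; rewrite prodf_seq_neq0 => /allP W.
by apply/negP => /W /=; rewrite subrr eqxx.
Qed.

Let hol_quot (t : seq C) z : D z -> z \notin t ->
  holomorphic_at (fun w => Q w / \prod_(r <- t) (w - r)) z.
Proof.
move=> Dz zt; have := oD Dz; rewrite /holomorphic_at.
move=> nD; apply: filterS2 nD (near_notin zt) => w Dw wt.
exact/slope_derivable_derivable/slope_quot.
Qed.

Let hol_H z : D z -> holomorphic_at H z.
Proof.
move=> Dz; have := oD Dz; rewrite /holomorphic_at.
by apply: filterS => w; exact: hH.
Qed.

Let holD f g z : holomorphic_at f z -> holomorphic_at g z ->
  holomorphic_at (fun w => f w + g w) z.
Proof. by apply: filterS2 => w; exact: derivable_add. Qed.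

(** The roots being distinct, one factor [w - z] is split off and the remaining quotient [g] has a
    derivable slope at [z]. If [g z != 0] the pole is simple; otherwise [g w / (w - z)] is that
    slope [q], and [q z + H z] is the value that removes the singularity. *)
Let quotient_root z : D z -> z \in s -> exists v,
  pole F z \/ holomorphic_at (fun w => if w == z then v else F w) z.
Proof.
move=> Dz zs; pose t := rem z s.
have zt : z \notin t by rewrite /t mem_rem_uniq// inE eqxx.
pose g w := Q w / \prod_(r <- t) (w - r).
have FE w : w != z -> F w = g w / (w - z) + H w.
  by move=> wz; rewrite /F (perm_big _ (perm_to_rem zs)) big_cons invfM /g; ring.
have hg : holomorphic_at g z by exact: hol_quot.
have hgd : \forall w \near z^', derivable (fun w => g w / (w - z)) w 1.
  have := hg; move/nbhs_dnbhs; have : \forall w \near z^', w != z by exact: nbhs_dnbhs_neq.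
  apply: filterS2 => w wz dg; apply: derivable_mul; first exact: dg.
  by apply: derivable_inv; [rewrite subr_eq0|exact: derivable_subid].
have [g0|g0] := eqVneq (g z) 0; last first.
  (* The numerator is [F] put over the denominator [w - z]; the value 0 is arbitrary in this
     branch. *)
  exists 0; left; exists 1%N, (fun w => g w + (w - z) * H w); split => //.
  - apply: holD => //.
    apply: filterS (hol_H Dz) => w; apply: derivable_mul; exact: derivable_subid.
  - by rewrite subrr mul0r addr0.
  have : \forall w \near z^', w != z by exact: nbhs_dnbhs_neq.
  apply: filterS => w wz; rewrite FE// expr1; field; by rewrite subr_eq0.
have [q [gE dq]] : slope_derivable g z by exact: slope_quot.
exists (q z + H z); right.
have qE w : w != z -> q w = g w / (w - z).
  by move=> wz; rewrite gE g0 add0r mulrC mulKf// subr_eq0.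
have hq : holomorphic_at q z.
  apply: near_dnbhs_if => //.
  have := nbhs_dnbhs_neq z.
  have n1 : \forall w \near z^', {near w, (fun w => g w / (w - z)) =1 q}.
    have : \forall w \near z^', w != z by exact: nbhs_dnbhs_neq.
    apply: filterS => w wz; have : \forall v \near w, v \notin [:: z].
      by apply: near_notin; rewrite inE.
    by apply: filterS => v; rewrite inE => /qE ->.
  move=> _; apply: filterS2 n1 hgd => w; exact: near_eq_derivable.
apply: (holomorphic_near_eq _ (holD hq (hol_H Dz))).
by apply: (@filterE _ (nbhs z)) => w; case: eqVneq => [->//|wz]; rewrite FE// qE.
Qed.

(** At a removable root [F] carries the junk value of a division by 0, which would spoil
    [holomorphic_at]; [Z] differs from [F] only by the values chosen at the roots. Off the roots [Z]
    is holomorphic, which excludes poles there. *)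
Lemma meromorphic_quotient : exists Z : C -> C,
  [/\ forall z, z \notin s -> Z z = F z,
      meromorphic_on D Z &
      forall z, D z -> pole Z z -> z \in s].
Proof.
have /choice[v vP] : forall z, exists v, D z -> z \in s ->
    pole F z \/ holomorphic_at (fun w => if w == z then v else F w) z.
  move=> z; have [Dz|nDz] := pselect (D z); last by exists 0.
  have [zs|zs] := boolP (z \in s); last by exists 0.
  by have [v ?] := quotient_root Dz zs; exists v.
pose Z z := if z \in s then v z else F z.
have Zhol z : D z -> z \notin s -> holomorphic_at Z z.
  move=> Dz zs; apply: (holomorphic_near_eq _ (holD (hol_quot Dz zs) (hol_H Dz))).
  by apply: filterS (near_notin zs) => w /negbTE ws; rewrite /Z ws.
exists Z; split.
- by move=> z /negbTE zs; rewrite /Z zs.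
- move=> z Dz; have [zs|zs] := boolP (z \in s); last by left; exact: Zhol.
  have nz : \forall w \near z, w \notin rem z s.
    by apply: near_notin; rewrite mem_rem_uniq// inE eqxx.
  have nE w : w != z -> w \notin rem z s -> w \notin s.
    by move=> wz; rewrite mem_rem_uniq// inE wz.
  have [Fp|Fh] := vP z Dz zs; [right|left].
    apply: pole_near_eq Fp; have : \forall w \near z^', w != z by exact: nbhs_dnbhs_neq.
    move/nbhs_dnbhs : nz; apply: filterS2 => w wt wz.
    by rewrite /Z (negbTE (nE w wz wt)).
  apply: holomorphic_near_eq Fh; apply: filterS nz => w wt.
  by case: eqVneq => [->|wz]; rewrite /Z ?zs// (negbTE (nE w wz wt)).
- move=> z Dz pZ; apply/negPn/negP => zs.
  exact: pole_not_holomorphic pZ (Zhol z Dz zs).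
Qed.

End MeromorphicQuotient.
End Slope.

(** * Integrals depending on a complex exponent *)

Section ComplexIntegral.
Context d (T : measurableType d) (R : realType).
Variables (mu : {measure set T -> \bar R}) (D : set T).
Hypothesis mD : measurable D.
Implicit Types (F G : T -> R[i]) (M : T -> R).

Definition cmeasurable F : Prop :=
  measurable_fun D (fun p => Re (F p)) /\ measurable_fun D (fun p => Im (F p)).

Definition cinte F : Prop :=
  mu.-integrable D (fun p => (Re (F p))%:E) /\
  mu.-integrable D (fun p => (Im (F p))%:E).

Definition cint F : R[i] :=
  (\int[mu]_(p in D) Re (F p)) +i* (\int[mu]_(p in D) Im (F p)).

Lemma cmeasurable_real (f : T -> R) : measurable_fun D f ->
  cmeasurable (fun p => (f p)%:C).
Proof. by move=> mf; split => //=; exact: measurable_cst. Qed.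

Lemma cmeasurable_cst c : cmeasurable (fun=> c).
Proof. by split => /=; exact: measurable_cst. Qed.

Lemma cmeasurableD F G : cmeasurable F -> cmeasurable G ->
  cmeasurable (fun p => F p + G p).
Proof.
move=> [F1 F2] [G1 G2]; split.
  by under eq_fun do rewrite ReD; exact: measurable_funD.
by under eq_fun do rewrite ImD; exact: measurable_funD.
Qed.

Lemma cmeasurableM F G : cmeasurable F -> cmeasurable G ->
  cmeasurable (fun p => F p * G p).
Proof.
move=> [F1 F2] [G1 G2]; split.
  under eq_fun do rewrite ReM.
  by apply: measurable_funB; exact: measurable_funM.
under eq_fun do rewrite ImM.
by apply: measurable_funD; exact: measurable_funM.
Qed.

Lemma cinte_le F M : cmeasurable F -> mu.-integrable D (EFin \o M) ->
  (forall p, D p -> nrm (F p) <= M p) -> cinte F.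
Proof.
move=> [F1 F2] iM FM; split.
  apply: (le_integrable mD _ _ iM); first exact/measurable_EFinP.
  move=> p Dp; rewrite lee_fin; apply: le_trans (Re_le_nrm _) _.
  by apply: le_trans (FM p Dp) _; exact: ler_norm.
apply: (le_integrable mD _ _ iM); first exact/measurable_EFinP.
move=> p Dp; rewrite lee_fin; apply: le_trans (Im_le_nrm _) _.
by apply: le_trans (FM p Dp) _; exact: ler_norm.
Qed.

Lemma eq_cint F G : {in D, F =1 G} -> cint F = cint G.
Proof.
by move=> FG; apply: complexP; apply: eq_Rintegral => p /FG ->.
Qed.

Lemma eq_cinte F G : {in D, F =1 G} -> cinte F -> cinte G.
Proof.
move=> FG [F1 F2]; split.
  by apply: eq_integrable F1 => // p /FG ->.
by apply: eq_integrable F2 => // p /FG ->.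
Qed.

Lemma cinteD F G : cinte F -> cinte G -> cinte (fun p => F p + G p).
Proof.
move=> [F1 F2] [G1 G2]; split.
  by under eq_fun do rewrite ReD EFinD; exact: integrableD.
by under eq_fun do rewrite ImD EFinD; exact: integrableD.
Qed.

Lemma cintD F G : cinte F -> cinte G ->
  cint (fun p => F p + G p) = cint F + cint G.
Proof.
move=> [F1 F2] [G1 G2]; apply: complexP; rewrite /cint/=.
  by under eq_Rintegral do rewrite ReD; rewrite RintegralD.
by under eq_Rintegral do rewrite ImD; rewrite RintegralD.
Qed.

Let integrableZ (k : R) (f : T -> R) : mu.-integrable D (EFin \o f) ->
  mu.-integrable D (EFin \o (fun p => k * f p)).
Proof.
move=> /(integrableZl mD k) h.
by apply: eq_integrable h => // p _ /=; rewrite EFinM.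
Qed.

Let integrableB' (f g : T -> R) : mu.-integrable D (EFin \o f) ->
  mu.-integrable D (EFin \o g) ->
  mu.-integrable D (EFin \o (fun p => f p - g p)).
Proof.
move=> hf hg; apply: eq_integrable (integrableB mD hf hg) => // p _ /=.
Qed.

Let integrableD' (f g : T -> R) : mu.-integrable D (EFin \o f) ->
  mu.-integrable D (EFin \o g) ->
  mu.-integrable D (EFin \o (fun p => f p + g p)).
Proof.
move=> hf hg; apply: eq_integrable (integrableD mD hf hg) => // p _ /=.
Qed.

Lemma cinteZ c F : cinte F -> cinte (fun p => c * F p).
Proof.
move=> [F1 F2]; split.
  under eq_fun do rewrite ReM; apply: integrableB'; exact: integrableZ.
under eq_fun do rewrite ImM; apply: integrableD'; exact: integrableZ.
Qed.

Lemma cintZ c F : cinte F -> cint (fun p => c * F p) = c * cint F.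
Proof.
move=> [F1 F2]; apply: complexP; rewrite /cint/=.
  under eq_Rintegral do rewrite ReM.
  rewrite RintegralB//; [|exact: integrableZ..].
  by rewrite !RintegralZl// ReM.
under eq_Rintegral do rewrite ImM.
rewrite RintegralD//; [|exact: integrableZ..].
by rewrite !RintegralZl// ImM.
Qed.

(** The factor 2 comes from estimating real and imaginary parts separately; only the finiteness of
    the bound matters later. *)
Lemma nrm_cint_le F M : cinte F -> mu.-integrable D (EFin \o M) ->
  (forall p, D p -> nrm (F p) <= M p) ->
  nrm (cint F) <= 2 * \int[mu]_(p in D) M p.
Proof.
move=> [F1 F2] iM FM; apply: le_trans (nrm_le _) _.
rewrite mulr_natl mulr2n /cint/=; apply: lerD.
  apply: le_trans (le_normr_Rintegral mD F1) _.
  apply: le_Rintegral => //; first exact: integrable_norm F1.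
  by move=> p Dp; apply: le_trans (Re_le_nrm _) (FM p Dp).
apply: le_trans (le_normr_Rintegral mD F2) _.
apply: le_Rintegral => //; first exact: integrable_norm F2.
by move=> p Dp; apply: le_trans (Im_le_nrm _) (FM p Dp).
Qed.

(** This replaces differentiation under the integral sign: a pointwise expansion in [h] whose
    remainder has a majorant [M] independent of [h] integrates term by term. *)
Lemma cint_derivable (K : R[i] -> T -> R[i]) (A : T -> R[i]) M (z : R[i]) (r : R) :
  0 < r -> (forall h, nrm h < r -> cinte (K (z + h))) -> cinte A ->
  mu.-integrable D (EFin \o M) ->
  (forall h p, nrm h < r -> D p ->
    nrm (K (z + h) p - K z p - h * A p) <= nrm h ^+ 2 * M p) ->
  cderivable (fun s => cint (K s)) z.
Proof.
move=> r0 iK iA iM KM.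
apply: (@derivable_taylor _ _ z (cint A) (2 * \int[mu]_(p in D) M p)%:C r%:C).
  by rewrite ltcR.
move=> h _; rewrite normE ltcR => hr.
have iK0 : cinte (K z) by rewrite -[z]addr0; apply: iK; rewrite nrm0.
have i1 : cinte (fun p => K (z + h) p + -1 * K z p).
  by apply: cinteD; [exact: iK|exact: cinteZ].
have E : cint (K (z + h)) - cint (K z) - h * cint A =
    cint (fun p => K (z + h) p + -1 * K z p + (- h) * A p).
  rewrite (cintD i1); last exact: cinteZ.
  rewrite cintD; [|exact: iK|exact: cinteZ].
  by rewrite !cintZ// mulN1r !mulNr.
rewrite E !normE -rmorphXn -rmorphM/= lecR.
have iN : mu.-integrable D (EFin \o (fun p => nrm h ^+ 2 * M p)).
  exact: integrableZ.
apply: le_trans (nrm_cint_le (M := fun p => nrm h ^+ 2 * M p) _ iN _) _.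
- by apply: cinteD => //; exact: cinteZ.
- by move=> p Dp; rewrite mulN1r mulNr; exact: KM.
- by rewrite RintegralZl//; lra.
Qed.

(** Same mechanism one order higher, ending in [slope_derivable_taylor]; it is what the numerator of
    a quotient has to satisfy. *)
Lemma cint_slope_derivable (K : R[i] -> T -> R[i]) (A B : T -> R[i]) M
    (z : R[i]) (r : R) :
  0 < r -> (forall h, nrm h < r -> cinte (K (z + h))) -> cinte A -> cinte B ->
  mu.-integrable D (EFin \o M) ->
  (forall h p, nrm h < r -> D p ->
    nrm (K (z + h) p - K z p - h * A p - h ^+ 2 * B p) <= nrm h ^+ 3 * M p) ->
  slope_derivable (fun s => cint (K s)) z.
Proof.
move=> r0 iK iA iB iM KM.
apply: (@slope_derivable_taylor _ _ z (cint A) (cint B)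
  (2 * \int[mu]_(p in D) M p)%:C r%:C).
  by rewrite ltcR.
move=> h; rewrite normE ltcR => hr.
have iK0 : cinte (K z) by rewrite -[z]addr0; apply: iK; rewrite nrm0.
have i1 : cinte (fun p => K (z + h) p + -1 * K z p).
  by apply: cinteD; [exact: iK|exact: cinteZ].
have i2 : cinte (fun p => K (z + h) p + -1 * K z p + (- h) * A p).
  by apply: cinteD => //; exact: cinteZ.
have E : cint (K (z + h)) - cint (K z) - h * cint A - h ^+ 2 * cint B =
    cint (fun p => K (z + h) p + -1 * K z p + (- h) * A p + - h ^+ 2 * B p).
  rewrite (cintD i2); last exact: cinteZ.
  rewrite (cintD i1); last exact: cinteZ.
  rewrite cintD; [|exact: iK|exact: cinteZ].
  by rewrite !cintZ// mulN1r !mulNr.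
rewrite E !normE -rmorphXn -rmorphM/= lecR.
have iN : mu.-integrable D (EFin \o (fun p => nrm h ^+ 3 * M p)).
  exact: integrableZ.
apply: le_trans (nrm_cint_le (M := fun p => nrm h ^+ 3 * M p) _ iN _) _.
- by apply: cinteD => //; exact: cinteZ.
- by move=> p Dp; rewrite mulN1r !mulNr; exact: KM.
- by rewrite RintegralZl//; lra.
Qed.

End ComplexIntegral.

(** * Complex powers of a real number and their majorants *)

Section PowerKernel.
Context {R : realType}.

(* The junk value [0] at [t <= 0] agrees with [cpowR] at [t = 0] as soon as
   [Re s != 0]. *)
Definition cpw (t : R) (s : R[i]) : R[i] :=
  if 0 < t then cexp (s * (ln t)%:C) else 0.

Definition rpw (t x : R) : R := if 0 < t then expR (x * ln t) else 0.

Lemma nrm_cpw t s : nrm (cpw t s) = rpw t (Re s).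
Proof.
rewrite /cpw /rpw; case: ifP => _; last by rewrite nrm0.
by rewrite nrm_cexp ReM/= mulr0 subr0.
Qed.

Lemma rpw_ge0 t x : 0 <= rpw t x.
Proof. by rewrite /rpw; case: ifP => // _; exact: expR_ge0. Qed.

Lemma cpwE t s : 0 <= t -> Re s != 0 -> cpowR t s = cpw t s.
Proof.
move=> t0 s0; rewrite /cpowR /cpw; case: ltgtP t0 => // [t0 _|<- _].
  rewrite /cexp ReM ImM/= !mulr0 subr0 add0r /powR gt_eqF//.
by rewrite powR0// !mul0r.
Qed.

Lemma measurable_Re_cpw s : measurable_fun setT (fun t => Re (cpw t s)).
Proof.
under eq_fun do rewrite /cpw (fun_if (@complex.Re R)) /cexp ReM/= mulr0 subr0.
apply: measurable_fun_ifT => //=.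
  exact: measurable_fun_ltr.
under eq_fun do rewrite ImM/= mulr0 add0r.
have mln c : measurable_fun setT (fun t : R => c * ln t).
  by apply: measurable_funM => //; exact: measurable_ln.
apply: measurable_funM; apply: measurableT_comp => //.
by apply: continuous_measurable_fun; exact: continuous_cos.
Qed.

Lemma measurable_Im_cpw s : measurable_fun setT (fun t => Im (cpw t s)).
Proof.
under eq_fun do rewrite /cpw (fun_if (@complex.Im R)) /cexp ReM/= mulr0 subr0.
apply: measurable_fun_ifT => //=.
  exact: measurable_fun_ltr.
under eq_fun do rewrite ImM/= mulr0 add0r.
have mln c : measurable_fun setT (fun t : R => c * ln t).
  by apply: measurable_funM => //; exact: measurable_ln.
apply: measurable_funM; apply: measurableT_comp => //.
by apply: continuous_measurable_fun; exact: continuous_sin.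
Qed.

Lemma measurable_rpw x : measurable_fun setT (rpw ^~ x).
Proof.
apply: measurable_fun_ifT => //=; first exact: measurable_fun_ltr.
apply: measurableT_comp => //.
by apply: measurable_funM => //; exact: measurable_ln.
Qed.

(** The margin [2 * e] is spent in two halves: one pays for the powers of the logarithm [l], the
    other for the factor [expR (e * |l|)] of the Taylor remainders. The sign of [l] decides which of
    the exponents [s1] and [s2] dominates. *)
Lemma expR_weight (x s1 s2 e l : R) (n : nat) : (n <= 3)%N -> 0 < e ->
  s1 <= x - 2 * e -> x + 2 * e <= s2 ->
  expR (x * l) * `|l| ^+ n * expR (e * `|l|) <=
  (3 / e) ^+ n * (expR (s1 * l) + expR (s2 * l)).
Proof.
move=> n3 e0 s1x s2x.
have h1 : `|l| ^+ n <= (3 / e) ^+ n * expR (e * `|l|).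
  (* The constant 3 is the largest [n]: with [e / 3] in the exponent, the [n]-th power still has
     exponent at most [e]. *)
  have l3 : `|l| <= 3 / e * expR (e / 3 * `|l|).
    rewrite -ler_pdivrMl ?divr_gt0// invf_div.
    by apply: le_trans (expR_ge1Dx _); rewrite lerDr.
  apply: (@le_trans _ _ ((3 / e * expR (e / 3 * `|l|)) ^+ n)).
    by rewrite lerXn2r ?nnegrE// mulr_ge0 ?expR_ge0 ?divr_ge0 ?ltW.
  rewrite exprMn ler_wpM2l//; first by rewrite exprn_ge0// divr_ge0// ltW.
  rewrite -expRM_natl ler_expR mulrA ler_wpM2r// mulrC -mulrA ger_pMr//.
  by rewrite ler_pdivrMl// mulr1 (ler_nat _ n 3).
have h2 : expR (x * l) * (expR (e * `|l|) * expR (e * `|l|)) <=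
    expR (s1 * l) + expR (s2 * l).
  rewrite -!expRD; have [l0|l0] := leP 0 l.
    rewrite ger0_norm//; apply: ler_wpDl; first exact: expR_ge0.
    by rewrite ler_expR -!mulrDl ler_wpM2r//; lra.
  rewrite ltr0_norm//; apply: ler_wpDr; first exact: expR_ge0.
  by rewrite ler_expR; nra.
apply: (@le_trans _ _ ((3 / e) ^+ n *
    (expR (x * l) * (expR (e * `|l|) * expR (e * `|l|))))).
  rewrite [leRHS](_ : _ = expR (x * l) * ((3 / e) ^+ n * expR (e * `|l|)) *
    expR (e * `|l|)); last by ring.
  by rewrite ler_wpM2r ?expR_ge0// ler_wpM2l ?expR_ge0.
by rewrite ler_wpM2l//; rewrite exprn_ge0// divr_ge0// ltW.
Qed.

Lemma rpw_weight (x s1 s2 e t : R) (n : nat) : (n <= 3)%N -> 0 < e ->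
  s1 <= x - 2 * e -> x + 2 * e <= s2 ->
  rpw t x * `|ln t| ^+ n * expR (e * `|ln t|) <=
  (3 / e) ^+ n * (rpw t s1 + rpw t s2).
Proof.
move=> n3 e0 h1 h2; rewrite /rpw; case: ifP => _; first exact: expR_weight.
by rewrite !mul0r addr0 mulr0.
Qed.

Lemma rpw_le (s1 x s2 t : R) : s1 <= x -> x <= s2 ->
  rpw t x <= rpw t s1 + rpw t s2.
Proof.
move=> s1x xs2; rewrite /rpw; case: ifP => _; last by rewrite addr0.
have [l0|l0] := leP 0 (ln t).
  by apply: ler_wpDl; [exact: expR_ge0|rewrite ler_expR ler_wpM2r].
by apply: ler_wpDr; [exact: expR_ge0|rewrite ler_expR; nra].
Qed.

End PowerKernel.

Section PowerIntegral.
Context d (T : measurableType d) (R : realType).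
Variables (mu : {measure set T -> \bar R}) (D : set T).
Hypothesis mD : measurable D.

Lemma cmeasurable_cpw (t : T -> R) (s : R[i]) : measurable_fun D t ->
  cmeasurable D (fun p => cpw (t p) s).
Proof.
move=> mt; split.
  exact: measurableT_comp (measurable_Re_cpw s) mt.
exact: measurableT_comp (measurable_Im_cpw s) mt.
Qed.

Section Kernel.
Variables (t g : T -> R) (s1 s2 : R).
Hypotheses (mt : measurable_fun D t) (mg : measurable_fun D g).
Hypotheses (i1 : mu.-integrable D (EFin \o (fun p => rpw (t p) s1 * `|g p|)))
  (i2 : mu.-integrable D (EFin \o (fun p => rpw (t p) s2 * `|g p|))).

Let integrable_weight (c : R) : mu.-integrable D
  (EFin \o (fun p => c * (rpw (t p) s1 + rpw (t p) s2) * `|g p|)).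
Proof.
have := integrableZl mD c (integrableD mD i1 i2).
by apply: eq_integrable => // p _ /=; rewrite -EFinD -EFinM -mulrA mulrDl.
Qed.

Lemma cinte_power (s : R[i]) : s1 <= Re s -> Re s <= s2 ->
  cinte mu D (fun p => cpw (t p) s * (g p)%:C).
Proof.
move=> h1 h2; apply: (cinte_le mD _ (integrable_weight 1)).
  by apply: cmeasurableM; [exact: cmeasurable_cpw|exact: cmeasurable_real].
move=> p _; rewrite nrmM nrmC nrm_cpw mul1r ler_wpM2r//.
exact: rpw_le.
Qed.

(** The expansion of [t ^ (z + h)] to second order has coefficients [ln t] and [(ln t)^2 / 2] and
    remainder [t ^ z] times [cexp_rem2 (h * ln t)]. By [rpw_weight] all of these are dominated by
    the powers with exponents [s1] and [s2], [e] being half the distance from [Re z] to the nearer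
    of the two. *)
Lemma cint_power_slope (z : R[i]) : s1 < Re z -> Re z < s2 ->
  slope_derivable (fun s => cint mu D (fun p => cpw (t p) s * (g p)%:C)) z.
Proof.
move=> h1 h2; set e := Num.min (Re z - s1) (s2 - Re z) / 2.
have e0 : 0 < e by rewrite /e divr_gt0// lt_min !subr_gt0 h1.
have e2 : e * 2 = Num.min (Re z - s1) (s2 - Re z) by rewrite /e divfK.
have e1 : s1 <= Re z - 2 * e.
  have : e * 2 <= Re z - s1 by rewrite e2 ge_min lexx.
  by lra.
have e3 : Re z + 2 * e <= s2.
  have : e * 2 <= s2 - Re z by rewrite e2 ge_min lexx orbT.
  by lra.
have mlt : measurable_fun D (fun p => ln (t p)).
  exact: measurableT_comp (@measurable_ln R) mt.
have W n p : (n <= 3)%N -> rpw (t p) (Re z) * `|ln (t p)| ^+ n *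
    expR (e * `|ln (t p)|) * `|g p| <=
    (3 / e) ^+ n * (rpw (t p) s1 + rpw (t p) s2) * `|g p|.
  by move=> n3; rewrite ler_wpM2r// rpw_weight.
have il n : (n <= 3)%N ->
    cinte mu D (fun p => cpw (t p) z * ((ln (t p)) ^+ n * g p)%:C).
  move=> n3; apply: (cinte_le mD _ (integrable_weight ((3 / e) ^+ n))).
    apply: cmeasurableM; first exact: cmeasurable_cpw.
    by apply: cmeasurable_real; apply: measurable_funM => //; exact: measurable_funX.
  move=> p _; apply: le_trans (W n p n3).
  rewrite nrmM nrmC nrm_cpw normrM normrX mulrA ler_wpM2r//.
  rewrite ler_peMr// ?mulr_ge0 ?rpw_ge0 ?exprn_ge0//.
  by rewrite -expR0 ler_expR mulr_ge0// ltW.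
apply: (@cint_slope_derivable _ _ _ _ _ mD
  (fun s p => cpw (t p) s * (g p)%:C)
  (fun p => cpw (t p) z * ((ln (t p)) ^+ 1 * g p)%:C)
  (fun p => 2^-1 * (cpw (t p) z * ((ln (t p)) ^+ 2 * g p)%:C))
  (fun p => (3 / e) ^+ 3 * (rpw (t p) s1 + rpw (t p) s2) * `|g p|) z e) => //.
- move=> h he; have := le_lt_trans (Re_le_nrm h) he.
  rewrite ltr_norml => /andP[? ?].
  by apply: cinte_power; rewrite ReD; lra.
- exact: il.
- by apply: cinteZ => //; exact: il.
move=> h p he Dp; rewrite (_ : cpw (t p) (z + h) * (g p)%:C - _ - _ - _ =
    cpw (t p) z * cexp_rem2 (h * (ln (t p))%:C) * (g p)%:C); last first.
  rewrite /cpw; case: ifP => _; last by rewrite !mul0r !mulr0 !subr0.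
  rewrite mulrDl cexpD /cexp_rem2 !rmorphM !rmorphXn/=.
  by field.
rewrite nrmM nrmM nrmC nrm_cpw.
apply: (@le_trans _ _ (nrm h ^+ 3 * (rpw (t p) (Re z) * `|ln (t p)| ^+ 3 *
    expR (e * `|ln (t p)|) * `|g p|))); last first.
  by rewrite ler_wpM2l ?exprn_ge0 ?nrm_ge0 ?W.
rewrite [leRHS](_ : _ = rpw (t p) (Re z) *
  (nrm h ^+ 3 * (`|ln (t p)| ^+ 3 * expR (e * `|ln (t p)|))) * `|g p|); last by ring.
rewrite ler_wpM2r// ler_wpM2l ?rpw_ge0//.
apply: le_trans (cexp_rem2_le _) _; rewrite nrmM nrmC exprMn -mulrA.
rewrite ler_wpM2l ?exprn_ge0 ?nrm_ge0// ler_wpM2l ?exprn_ge0//.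
by rewrite ler_expR ler_wpM2r// ltW.
Qed.

End Kernel.

(** The difference of the powers is [t2 ^ s * (exp (s * la) - 1)] with [la = ln t1 - ln t2], and the
    second factor is [O(la)] for bounded [s]. Integrability is thus asked only of [t2 ^ s * la * g],
    not of [t2 ^ s * g]. First order expansion suffices, since this integral is never divided by a
    vanishing factor. *)
Lemma cint_powerB_derivable (t1 t2 g : T -> R) (s1 s2 : R) (z : R[i]) :
  measurable_fun D t1 -> measurable_fun D t2 -> measurable_fun D g ->
  (forall p, D p -> g p != 0 ->
     [/\ 0 < t1 p, 0 < t2 p & `|ln (t1 p) - ln (t2 p)| <= 1]) ->
  mu.-integrable D
    (EFin \o (fun p => rpw (t2 p) s1 * `|(ln (t1 p) - ln (t2 p)) * g p|)) ->
  mu.-integrable D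
    (EFin \o (fun p => rpw (t2 p) s2 * `|(ln (t1 p) - ln (t2 p)) * g p|)) ->
  s1 < Re z -> Re z < s2 ->
  cinte mu D (fun p => (cpw (t1 p) z - cpw (t2 p) z) * (g p)%:C) /\
  cderivable
    (fun s => cint mu D (fun p => (cpw (t1 p) s - cpw (t2 p) s) * (g p)%:C)) z.
Proof.
move=> mt1 mt2 mg tg i1 i2 h1 h2.
set e := Num.min 1 (Num.min (Re z - s1) (s2 - Re z) / 2).
have e0 : 0 < e by rewrite /e lt_min ltr01 divr_gt0// lt_min !subr_gt0 h1.
have eL1 : e <= 1 by rewrite /e ge_min lexx.
have e2 : e * 2 <= Num.min (Re z - s1) (s2 - Re z).
  by rewrite -ler_pdivlMr// /e ge_min lexx orbT.
have e1 : s1 <= Re z - 2 * e.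
  by move: e2; rewrite le_min => /andP[? ?]; lra.
have e3 : Re z + 2 * e <= s2.
  by move: e2; rewrite le_min => /andP[? ?]; lra.
pose la p := ln (t1 p) - ln (t2 p).
have mlt1 : measurable_fun D (fun p => ln (t1 p)).
  exact: measurableT_comp (@measurable_ln R) mt1.
have mlt2 : measurable_fun D (fun p => ln (t2 p)).
  exact: measurableT_comp (@measurable_ln R) mt2.
have mla : measurable_fun D la by exact: measurable_funB.
have iW (c : R) : mu.-integrable D
    (EFin \o (fun p => c * (rpw (t2 p) s1 + rpw (t2 p) s2) * `|la p * g p|)).
  have := integrableZl mD c (integrableD mD i1 i2).
  apply: eq_integrable => // p _ /=; rewrite -EFinD -EFinM; congr (_%:E).
  by rewrite /la; ring.
(* [nrm z + 2] exceeds [nrm (z + h)] and the exponent [nrm z + 1] met below, and it is at least 1,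
   so that [C0] also dominates the bare exponential. *)
pose C0 : R := (nrm z + 2) * expR (nrm z + 2).
have z2 : 0 < nrm z + 2 by rewrite ltr_wpDl ?nrm_ge0.
have C00 : 0 <= C0 by rewrite mulr_ge0 ?expR_ge0 ?ltW.
have E0 : expR (nrm z + 2) <= C0.
  by rewrite ler_peMl ?expR_ge0//; have := nrm_ge0 z; lra.
have b0 h p : nrm h < e -> `|la p| <= 1 ->
    nrm (cexp ((z + h) * (la p)%:C) - 1) <= C0 * `|la p|.
  move=> he l1; apply: le_trans (cexp_sub1 _) _.
  rewrite nrmM nrmC mulrAC ler_wpM2r//.
  have zh : nrm (z + h) <= nrm z + 2 by have := nrmD z h; lra.
  rewrite ler_pM ?nrm_ge0 ?expR_ge0// ler_expR.
  by apply: le_trans zh; rewrite ler_piMr ?nrm_ge0.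
have b1 p : `|la p| <= 1 -> nrm (cexp (z * (la p)%:C)) <= expR (nrm z).
  move=> l1; rewrite nrm_cexp ler_expR; apply: le_trans (ler_norm _) _.
  apply: le_trans (Re_le_nrm _) _; rewrite nrmM nrmC.
  by rewrite ler_piMr ?nrm_ge0.
have br h p : nrm h < e -> `|la p| <= 1 ->
    nrm (cexp (z * (la p)%:C) * cexp_rem1 (h * (la p)%:C)) <=
    nrm h ^+ 2 * (C0 * `|la p|).
  move=> he l1; rewrite nrmM; apply: (@le_trans _ _ (expR (nrm z) *
      (nrm h ^+ 2 * `|la p| ^+ 2 * expR 1))).
    rewrite ler_pM ?nrm_ge0 ?b1//; apply: le_trans (cexp_rem1_le _) _.
    rewrite nrmM nrmC exprMn ler_wpM2l ?mulr_ge0 ?exprn_ge0 ?nrm_ge0//.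
    rewrite ler_expR; have := nrm_ge0 h; have := normr_ge0 (la p); nra.
  rewrite [leLHS](_ : _ = nrm h ^+ 2 * (expR (nrm z) * expR 1 * `|la p| ^+ 2));
    last by ring.
  rewrite ler_wpM2l ?exprn_ge0 ?nrm_ge0// -expRD.
  apply: ler_pM; rewrite ?expR_ge0//; last first.
    by rewrite expr2 ler_piMr.
  by apply: le_trans E0; rewrite ler_expR; lra.
have W n p : (n <= 3)%N -> rpw (t2 p) (Re z) * `|ln (t2 p)| ^+ n *
    expR (e * `|ln (t2 p)|) <=
    (3 / e) ^+ n * (rpw (t2 p) s1 + rpw (t2 p) s2).
  by move=> n3; rewrite rpw_weight.
pose K s p := (cpw (t1 p) s - cpw (t2 p) s) * (g p)%:C.
have KE s p : D p -> K s p =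
    cpw (t2 p) s * (cexp (s * (la p)%:C) - 1) * (g p)%:C.
  move=> Dp; rewrite /K; have [->|g0] := eqVneq (g p) 0; first by rewrite !mulr0.
  have [t10 t20 _] := tg p Dp g0; rewrite /cpw t10 t20.
  rewrite mulrBr mulr1 -cexpD -mulrDr -rmorphD/= (_ : ln (t2 p) + la p = ln (t1 p))//.
  by rewrite /la addrC subrK.
have mK s : cmeasurable D (K s).
  apply: cmeasurableM; last exact: cmeasurable_real.
  have := cmeasurable_cpw s mt1; have := cmeasurable_cpw s mt2.
  move=> m2 m1; have := cmeasurableD m1 (cmeasurableM (cmeasurable_cst D (-1)) m2).
  by under eq_fun do rewrite mulN1r.
have iK h : nrm h < e -> cinte mu D (K (z + h)).
  move=> he; apply: (cinte_le mD (mK _) (iW C0)) => p Dp.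
  rewrite KE//; have [->|g0] := eqVneq (g p) 0.
    by rewrite !mulr0 nrm0 normr0 mulr0.
  have [_ _ l1] := tg p Dp g0.
  rewrite !nrmM nrmC nrm_cpw normrM [leRHS]mulrA ler_wpM2r//.
  rewrite [leRHS]mulrAC mulrC ler_pM ?nrm_ge0 ?rpw_ge0 ?b0//.
  have := le_lt_trans (Re_le_nrm h) he.
  rewrite ltr_norml => /andP[? ?].
  by apply: rpw_le; rewrite ReD; lra.
split; first by have := iK 0; rewrite nrm0 addr0; exact.
(* This is the derivative [ln t1 * t1 ^ z - ln t2 * t2 ^ z], arranged so that each summand contains
   a factor of size [la]. *)
pose A p := cpw (t2 p) z * ((ln (t2 p))%:C * (cexp (z * (la p)%:C) - 1) +
   (la p)%:C * cexp (z * (la p)%:C)) * (g p)%:C.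
have mE s : cmeasurable D (fun p => cexp (s * (la p)%:C)).
  have m1 : measurable_fun D (fun p => expR (la p)).
    exact: measurableT_comp mla.
  have := cmeasurable_cpw s m1; rewrite /cpw.
  by under eq_fun do rewrite expR_gt0 expRK.
have W1 p : rpw (t2 p) (Re z) * (1 + `|ln (t2 p)|) ^+ 2 *
    expR (e * `|ln (t2 p)|) <=
    (1 + 2 * (3 / e) + (3 / e) ^+ 2) * (rpw (t2 p) s1 + rpw (t2 p) s2).
  have := W 0%N p isT; have := W 1%N p isT; have := W 2%N p isT.
  rewrite !expr0 !expr1; lra.
have rE1 p : rpw (t2 p) (Re z) <= rpw (t2 p) (Re z) * expR (e * `|ln (t2 p)|).
  by rewrite ler_peMr ?rpw_ge0// -expR0 ler_expR mulr_ge0// ltW.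
apply: (@cint_derivable _ _ _ _ _ mD K A
  (fun p => C0 * (1 + 2 * (3 / e) + (3 / e) ^+ 2) *
     (rpw (t2 p) s1 + rpw (t2 p) s2) * `|la p * g p|) z e) => //.
- apply: (cinte_le mD _ (iW (C0 * (1 + 2 * (3 / e) + (3 / e) ^+ 2)))).
    apply: cmeasurableM; last exact: cmeasurable_real.
    apply: cmeasurableM; first exact: cmeasurable_cpw.
    apply: cmeasurableD; apply: cmeasurableM => //; try exact: cmeasurable_real.
    by apply: cmeasurableD => //; exact: cmeasurable_cst.
  move=> p Dp; rewrite /A; have [->|g0] := eqVneq (g p) 0.
    by rewrite !mulr0 nrm0 normr0 mulr0.
  have [_ _ l1] := tg p Dp g0.
  rewrite !nrmM nrmC nrm_cpw normrM [leRHS]mulrA ler_wpM2r//.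
  apply: (@le_trans _ _ (C0 * (rpw (t2 p) (Re z) * (1 + `|ln (t2 p)|) ^+ 2 *
    expR (e * `|ln (t2 p)|)) * `|la p|)); last first.
    rewrite ler_wpM2r// [leRHS](_ : _ = C0 * ((1 + 2 * (3 / e) + (3 / e) ^+ 2) *
      (rpw (t2 p) s1 + rpw (t2 p) s2))); last by ring.
    by rewrite ler_wpM2l.
  apply: (@le_trans _ _ (rpw (t2 p) (Re z) * ((1 + `|ln (t2 p)|) ^+ 2 * (C0 * `|la p|)))).
    rewrite ler_wpM2l ?rpw_ge0//; apply: le_trans (nrmD _ _) _.
    rewrite !nrmM !nrmC.
    have B0 : nrm (cexp (z * (la p)%:C) - 1) <= C0 * `|la p|.
      by have := b0 0 p; rewrite nrm0 addr0; apply.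
    have B1 : `|la p| * nrm (cexp (z * (la p)%:C)) <= C0 * `|la p|.
      rewrite mulrC ler_wpM2r//; apply: le_trans (b1 p l1) _.
      by apply: le_trans E0; rewrite ler_expR lerDl.
    have := ler_wpM2l (normr_ge0 (ln (t2 p))) B0.
    have : 0 <= C0 * `|la p| by rewrite mulr_ge0.
    have := normr_ge0 (ln (t2 p)); move: (nrm _) (C0 * _) B1 => X Y B1.
    have := sqr_ge0 (`|ln (t2 p)|); nra.
  rewrite [leLHS](_ : _ = rpw (t2 p) (Re z) *
     (C0 * (1 + `|ln (t2 p)|) ^+ 2 * `|la p|)); last by ring.
  rewrite [leRHS](_ : _ = rpw (t2 p) (Re z) * expR (e * `|ln (t2 p)|) *
     (C0 * (1 + `|ln (t2 p)|) ^+ 2 * `|la p|)); last by ring.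
  apply: ler_wpM2r; last exact: rE1.
  have LL : 0 <= 1 + `|ln (t2 p)| by exact: addr_ge0.
  exact: mulr_ge0 (mulr_ge0 C00 (exprn_ge0 2 LL)) (normr_ge0 _).
move=> h p he Dp; rewrite !KE// /A; have [->|g0] := eqVneq (g p) 0.
  by rewrite !mulr0 !subr0 nrm0 normr0 !mulr0.
have [_ t20 l1] := tg p Dp g0.
set l2 := ln (t2 p); set b := cexp ((z + h) * (la p)%:C) - 1.
set rb := cexp (z * (la p)%:C) * cexp_rem1 (h * (la p)%:C).
set b' := cexp (z * (la p)%:C).
(* The remainder is split into the remainder of [exp (h * la)], the cross term in [h ^ 2], and the
   remainder of [exp (h * l2)]. Each is quadratic in [h] and still of size [la]. *)
rewrite [X in nrm X](_ : _ = cpw (t2 p) z * ((1 + h * l2%:C) * rb +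
   h ^+ 2 * (l2%:C * ((la p)%:C * b')) + cexp_rem1 (h * l2%:C) * b) * (g p)%:C);
   last first.
  rewrite /b /rb /b' /cpw t20 !(mulrDl z h) !cexpD /cexp_rem1 -/l2.
  by ring.
rewrite !nrmM nrmC nrm_cpw normrM.
rewrite [leRHS](_ : _ = nrm h ^+ 2 * (C0 * ((1 + 2 * (3 / e) + (3 / e) ^+ 2) *
  (rpw (t2 p) s1 + rpw (t2 p) s2)) * `|la p|) * `|g p|); last by ring.
rewrite ler_wpM2r//.
apply: (@le_trans _ _ (nrm h ^+ 2 * (C0 * (rpw (t2 p) (Re z) *
    (1 + `|l2|) ^+ 2 * expR (e * `|l2|)) * `|la p|))); last first.
  apply: ler_wpM2l; first by rewrite exprn_ge0 ?nrm_ge0.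
  by apply: ler_wpM2r => //; apply: ler_wpM2l => //; exact: W1.
rewrite [leRHS](_ : _ = rpw (t2 p) (Re z) * (nrm h ^+ 2 * (C0 * `|la p|) *
    ((1 + `|l2|) ^+ 2 * expR (e * `|l2|)))); last by ring.
rewrite ler_wpM2l ?rpw_ge0//.
set Y := C0 * `|la p|; have Y0 : 0 <= Y by rewrite mulr_ge0.
set E := expR (e * `|l2|).
have E1 : 1 <= E by rewrite -expR0 ler_expR mulr_ge0// ltW.
set H := nrm h ^+ 2; have H0 : 0 <= H by rewrite exprn_ge0 ?nrm_ge0.
set L := `|l2|; have L0 : 0 <= L by exact: normr_ge0.
have T1 : nrm ((1 + h * l2%:C) * rb) <= (1 + L) * (H * Y).
  rewrite nrmM ler_pM ?nrm_ge0 ?br//.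
  apply: le_trans (nrmD _ _) _; rewrite nrm1 lerD2l nrmM nrmC.
  by rewrite ler_piMl//; apply: le_trans eL1; exact: ltW.
have T2 : nrm (h ^+ 2 * (l2%:C * ((la p)%:C * b'))) <= H * (L * Y).
  rewrite nrmM nrmX ler_wpM2l// !nrmM !nrmC ler_wpM2l//.
  rewrite mulrC ler_wpM2r//; apply: le_trans (b1 p l1) _.
  by apply: le_trans E0; rewrite ler_expR lerDl.
have T3 : nrm (cexp_rem1 (h * l2%:C) * b) <= H * L ^+ 2 * E * Y.
  rewrite nrmM ler_pM ?nrm_ge0 ?b0//.
  apply: le_trans (cexp_rem1_le _) _; rewrite nrmM nrmC exprMn.
  apply: ler_wpM2l; first by rewrite mulr_ge0 ?sqr_ge0.
  by rewrite ler_expR ler_wpM2r// ltW.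
apply: le_trans (nrmD _ _) _; apply: le_trans (lerD (nrmD _ _) (lexx _)) _.
apply: (@le_trans _ _ (H * Y * (1 + 2 * L + L ^+ 2 * E))).
  by apply: le_trans (lerD (lerD T1 T2) T3) _; rewrite le_eqVlt; apply/orP; left; apply/eqP; ring.
apply: ler_wpM2l; first exact: mulr_ge0.
rewrite -subr_ge0 (_ : _ - _ = (1 + 2 * L) * (E - 1)); last by ring.
apply: mulr_ge0; last by rewrite subr_ge0.
by apply: addr_ge0 => //; exact: mulr_ge0.
Qed.

End PowerIntegral.

(** * Powers of a monic real polynomial *)

Section MonicPolynomialIntegral.
Context {R : realType}.
Let mu := @lebesgue_measure R.

Lemma rpwM (t t' x : R) : 0 < t -> 0 < t' -> rpw (t * t') x = rpw t x * rpw t' x.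
Proof.
by move=> t0 t0'; rewrite /rpw mulr_gt0// t0 t0' lnM// mulrDr expRD.
Qed.

Lemma rpwX (t x : R) n : 0 < t -> rpw (t ^+ n) x = rpw t (n%:R * x).
Proof.
by move=> t0; rewrite /rpw exprn_gt0// t0 lnXn//; congr expR; rewrite -mulr_natl; ring.
Qed.

Lemma rpw_nincr (t t' x : R) : x <= 0 -> 0 < t -> t <= t' -> rpw t' x <= rpw t x.
Proof.
move=> x0 t0 tt'; have t0' := lt_le_trans t0 tt'.
by rewrite /rpw t0 t0' ler_expR ler_wnM2l// ler_ln.
Qed.

Lemma rpw_ndecr (t t' x : R) : 0 <= x -> 0 < t -> t <= t' -> rpw t x <= rpw t' x.
Proof.
move=> x0 t0 tt'; have t0' := lt_le_trans t0 tt'.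
by rewrite /rpw t0 t0' ler_expR ler_wpM2l// ler_ln.
Qed.

(* A majorant of [|y - c| ^ q] by dyadic shells; unlike the power itself it
   stays a majorant when [y - c] is replaced by [y - z] with [c = Re z]. *)
Definition shell (q l c y : R) : \bar R :=
  ((rpw l q)%:E + \sum_(n <oo)
    (rpw (l / 2 ^+ n.+1) q * \1_(`[c - l / 2 ^+ n, c + l / 2 ^+ n]%classic) y)%:E)%E.

Let shell_term_ge0 (q l c y : R) n :
  (0 <= (rpw (l / 2 ^+ n.+1) q * \1_(`[c - l / 2 ^+ n, c + l / 2 ^+ n]%classic) y)%:E)%E.
Proof. by rewrite lee_fin mulr_ge0 ?rpw_ge0. Qed.

Lemma shell_ge0 (q l c y : R) : (0 <= shell q l c y)%E.
Proof.
by rewrite adde_ge0 ?lee_fin ?rpw_ge0//; apply: nneseries_ge0 => n _ _; exact: shell_term_ge0.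
Qed.

Lemma measurable_shell (q l c : R) (D : set R) : measurable D ->
  measurable_fun D (shell q l c).
Proof.
move=> mD; apply: emeasurable_funD; first exact: measurable_cst.
apply: ge0_emeasurable_sum => [n y _ _|n _]; first exact: shell_term_ge0.
apply/measurable_EFinP; apply: measurable_funM; first exact: measurable_cst.
exact: measurable_indic.
Qed.

Lemma dyadic_shell (l e : R) : 0 < e -> e <= l ->
  exists n : nat, l / 2 ^+ n.+1 < e <= l / 2 ^+ n.
Proof.
move=> e0 el; have l0 := lt_le_trans e0 el.
have ex : exists n : nat, l / 2 ^+ n.+1 < e.
  exists (Num.truncn (l / e)); rewrite ltr_pdivrMr ?exprn_gt0// mulrC -ltr_pdivrMr//.
  have /andP[_ h] := truncn_itv (divr_ge0 (ltW l0) (ltW e0)).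
  apply: lt_trans h _; rewrite -natrX ltr_nat; exact: ltn_expl.
exists (ex_minn ex); case: ex_minnP => -[|n] Hn min; rewrite Hn/=.
  by rewrite expr0 divr1.
by rewrite leNgt; apply/negP => /min; rewrite ltnn.
Qed.

(** If [e >= l] the constant term suffices. Otherwise [y] lies in the interval of the index [n] for
    which [l / 2 ^+ n.+1 < e <= l / 2 ^+ n], and its weight is a nonpositive power of a number
    smaller than [e]. *)
Lemma shell_ge (q l c e y : R) : q <= 0 -> 0 < l -> 0 < e -> `|y - c| <= e ->
  ((rpw e q)%:E <= shell q l c y)%E.
Proof.
move=> q0 l0 e0 yc; have [le|el] := leP l e.
  rewrite -[leLHS]adde0; apply: leeD; first by rewrite lee_fin rpw_nincr.
  by apply: nneseries_ge0 => n _ _; exact: shell_term_ge0.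
have [n /andP[ne en]] := dyadic_shell e0 (ltW el).
rewrite -[leLHS]add0e; apply: leeD; first by rewrite lee_fin rpw_ge0.
apply: (@le_trans _ _ (\sum_(0 <= i < n.+1)
  (rpw (l / 2 ^+ i.+1) q * \1_(`[c - l / 2 ^+ i, c + l / 2 ^+ i]%classic) y)%:E)%E).
  rewrite big_nat_recr//= -[leLHS]add0e; apply: leeD.
    by apply: sume_ge0 => i _; exact: shell_term_ge0.
  rewrite indicE mem_set ?mulr1 ?lee_fin.
    by apply: rpw_nincr => //; [rewrite divr_gt0 ?exprn_gt0|exact: ltW].
  rewrite /= in_itv/= -ler_distlC distrC; exact: le_trans yc en.
by apply: nneseries_lim_ge => i _ _; exact: shell_term_ge0.
Qed.

(** The [n]-th term integrates to at most its weight times the length [2 * l / 2 ^+ n], a geometric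
    sequence times [l ^ (1 + q)]. The constant must not depend on [c], since nothing is known about
    the location of the roots. *)
Lemma integral_shell (q : R) : -1 < q -> q <= 0 -> exists2 C : R, 0 <= C &
  forall l c : R, 0 < l ->
  (\int[mu]_(y in `[0%R, l]%classic) shell q l c y <= (C * rpw l (1 + q))%:E)%E.
Proof.
move=> q1 q0.
(* The common ratio [2 ^ -(1 + q)], which is less than 1 because [q > -1]. *)
pose x := expR (- (1 + q) * ln 2).
have ln20 : 0 < ln (2 : R) by rewrite ln_gt0// ltr1n.
have x1 : x < 1 by rewrite -expR0 ltr_expR nmulr_rlt0// oppr_lt0; lra.
have x0 : 0 < x by exact: expR_gt0.
pose A := 2 * expR (- q * ln 2).
have A0 : 0 <= A by rewrite mulr_ge0 ?expR_ge0.
exists (1 + A / (1 - x)).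
  by rewrite addr_ge0// divr_ge0// subr_ge0 ltW.
move=> l c l0.
have mI : measurable (`[0, l]%classic : set R) by exact: measurable_itv.
rewrite ge0_integralD//; last 3 first.
- by move=> y _; rewrite lee_fin rpw_ge0.
- by move=> y _; apply: nneseries_ge0 => n _ _; exact: shell_term_ge0.
- apply: ge0_emeasurable_sum => [n y _ _|n _]; first exact: shell_term_ge0.
  apply/measurable_EFinP; apply: measurable_funM; first exact: measurable_cst.
  exact: measurable_indic.
rewrite mulrDl mul1r EFinD; apply: leeD.
  have muI : mu (`[0, l]%classic : set R) = l%:E.
    by rewrite /mu lebesgue_measure_itv/= lte_fin l0 oppr0 adde0.
  apply: (@le_trans _ _ ((rpw l q)%:E * mu (`[0%R, l]%classic : set R))%E).
    by rewrite integral_cst.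
  rewrite muI -EFinM.
  by rewrite lee_fin /rpw l0 mulrDl expRD mul1r lnK// mulrC.
rewrite integral_nneseries//; last first.
  move=> n; apply/measurable_EFinP; apply: measurable_funM; first exact: measurable_cst.
  exact: measurable_indic.
apply: lime_le.
  by apply: is_cvg_nneseries => n _ _; apply: integral_ge0.
apply: nearW => n.
apply: (@le_trans _ _ (\sum_(0 <= i < n) (A * rpw l (1 + q) * x ^+ i)%:E)%E).
  apply: lee_sum => i _.
  under eq_integral do rewrite EFinM.
  rewrite ge0_integralZl_EFin//; last 2 first.
  - by apply/measurable_EFinP; exact: measurable_indic.
  - exact: rpw_ge0.
  rewrite integral_indic//.
  have li : 0 < l / 2 ^+ i by rewrite divr_gt0// exprn_gt0.
  apply: (@le_trans _ _ ((rpw (l / 2 ^+ i.+1) q)%:E * (2 * (l / 2 ^+ i))%:E)%E).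
    apply: lee_wpmul2l; first by rewrite lee_fin rpw_ge0.
    apply: (@le_trans _ _ (mu (`[c - l / 2 ^+ i, c + l / 2 ^+ i]%classic : set R))).
      apply: le_measure; rewrite ?inE//; exact: measurableI.
    rewrite /mu lebesgue_measure_itv/= lte_fin ifT ?lee_fin; last by lra.
    by lra.
  rewrite -EFinM lee_fin.
  have l2 j : ln (l / 2 ^+ j) = ln l - j%:R * ln 2.
    by rewrite ln_div ?posrE ?exprn_gt0// lnXn// mulr_natl.
  have lE : l / 2 ^+ i = expR (ln l - i%:R * ln 2) by rewrite -l2 lnK.
  rewrite /rpw divr_gt0 ?exprn_gt0// l2 lE l0 /A /x -expRM_natl.
  rewrite mulrCA -!mulrA ler_pM2l// -!expRD le_eqVlt; apply/orP; left.
  by apply/eqP; congr expR; rewrite -natr1; ring.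
rewrite sumEFin lee_fin -mulr_sumr [leRHS]mulrAC.
rewrite -mulrA [leRHS](_ : _ = A * rpw l (1 + q) * (1 - x)^-1); last by ring.
apply: ler_wpM2l; first by rewrite mulr_ge0 ?rpw_ge0.
have := @geometric_le_lim R n 1 x ler01 x0.
rewrite gtr0_norm// mul1r => /(_ x1); apply: le_trans.
by rewrite /series/= le_eqVlt; apply/orP; left; apply/eqP; apply: eq_bigr => i _; rewrite mul1r.
Qed.

Lemma nrm_prod (I : Type) (s : seq I) (F : I -> R[i]) :
  nrm (\prod_(r <- s) F r) = \prod_(r <- s) nrm (F r).
Proof.
by elim: s => [|r s IH]; rewrite ?big_nil ?nrm1// !big_cons nrmM IH.
Qed.

(* The smallest factor carries the whole power. *)
Lemma rpw_prod_le (s : seq R) (x : R) : x <= 0 -> (0 < size s)%N ->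
  (forall r, r \in s -> 0 < r) ->
  exists2 r, r \in s & rpw (\prod_(r <- s) r) x <= rpw r ((size s)%:R * x).
Proof.
move=> x0 s0 sp.
have [r rs rmin] : exists2 r, r \in s & forall r', r' \in s -> r <= r'.
  elim: s s0 {sp} => // a [|b s] IH _.
    by exists a; [rewrite mem_head|move=> r'; rewrite inE => /eqP ->].
  have [r rs rmin] := IH isT; have [ar|ra] := leP a r.
    exists a; first by rewrite mem_head.
    by move=> r'; rewrite inE => /predU1P[->//|/rmin]; exact: le_trans.
  exists r; first by rewrite inE rs orbT.
  by move=> r'; rewrite inE => /predU1P[->|/rmin//]; exact: ltW.
exists r => //; have r0 := sp r rs.
rewrite -rpwX//; apply: rpw_nincr => //; first exact: exprn_gt0.
elim: s rmin {s0 rs} sp => [|a s IH] rmin sp; first by rewrite big_nil expr0.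
rewrite big_cons exprS ler_pM ?exprn_ge0 ?(ltW r0)//; first by rewrite rmin ?mem_head.
by apply: IH => r' r's; [apply: rmin|apply: sp]; rewrite inE r's orbT.
Qed.

(** Over the complex numbers [|p.[y]|] is the product of the distances from [y] to the roots, and
    the smallest of them raised to the power [m] bounds it from below. The constant is uniform in
    [p], so the coefficients may later vary with [x]. *)
Lemma monic_integral_le (m : nat) (x : R) : (0 < m)%N -> - m%:R^-1 < x -> x <= 0 ->
  exists2 C : R, 0 <= C & forall (p : {poly R}) (l : R),
    p \is monic -> size p = m.+1 -> 0 < l ->
    (\int[mu]_(y in `[0%R, l]%classic) (rpw `|p.[y]| x)%:E <=
      (C * rpw l (1 + m%:R * x))%:E)%E.
Proof.
move=> m0 x1 x0; have m0' : 0 < m%:R :> R by rewrite ltr0n.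
have q1 : -1 < m%:R * x.
  by move: x1; rewrite -(ltr_pM2l m0') mulrN divff// gt_eqF.
have q0 : m%:R * x <= 0 by rewrite mulr_ge0_le0// ltW.
have [C C0 HC] := integral_shell q1 q0; exists (m%:R * C).
  by rewrite mulr_ge0.
move=> p l mp sp l0.
pose P := map_poly (real_complex R) p.
have [rs PE] := closed_field_poly_normal P.
have mP : P \is monic by rewrite map_monic.
move: PE; rewrite (monicP mP) scale1r => PE.
have srs : size rs = m.
  have : size P = m.+1 by rewrite size_map_poly.
  by rewrite PE size_prod_XsubC => -[].
have pE y : `|p.[y]| = \prod_(r <- [seq nrm (y%:C - r) | r <- rs]) r.
  rewrite -nrmC -[(p.[y])%:C]/(real_complex R p.[y]) -horner_map -/P PE.
  rewrite horner_prod nrm_prod big_map; apply: eq_bigr => r _.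
  by rewrite !hornerE.
(* The nearest root depends on [y]; summing over all roots avoids having to select it measurably. *)
have pw y : ((rpw `|p.[y]| x)%:E <= \sum_(r <- rs) shell (m%:R * x) l (Re r) y)%E.
  have [py0|py0] := eqVneq (p.[y]) 0.
    rewrite py0 normr0 /rpw ltxx; apply: sume_ge0 => r _; exact: shell_ge0.
  pose ds := [seq nrm (y%:C - r) | r <- rs].
  have dp d : d \in ds -> 0 < d.
    move=> /mapP[r rrs ->]; rewrite nrm_gt0; apply: contra_neq py0 => yr.
    apply/eqP; rewrite -normr_eq0 pE; apply/eqP.
    by rewrite big_map (big_rem r)//= yr nrm0 mul0r.
  have s0 : (0 < size ds)%N by rewrite size_map srs.
  have [d] := rpw_prod_le x0 s0 dp.
  rewrite size_map srs => /mapP[r rrs ->] hd.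
  rewrite pE; apply: (@le_trans _ _ (shell (m%:R * x) l (Re r) y)); last first.
    rewrite (big_rem r)//= leeDl//; apply: sume_ge0 => r' _; exact: shell_ge0.
  apply: le_trans (_ : ((rpw (nrm (y%:C - r)) (m%:R * x))%:E <= _)%E).
    by rewrite lee_fin.
  apply: shell_ge => //; first by apply: dp; apply/mapP; exists r.
  by have := Re_le_nrm (y%:C - r); rewrite ReD ReN.
have mI : measurable (`[0, l]%classic : set R) by exact: measurable_itv.
apply: (@le_trans _ _ (\int[mu]_(y in `[0%R, l]%classic)
  (\sum_(r <- rs) shell (m%:R * x) l (Re r) y))%E).
  apply: ge0_le_integral => //.
  - by move=> y _; rewrite lee_fin rpw_ge0.
  - apply/measurable_EFinP; apply: (measurableT_comp (measurable_rpw x)).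
    apply: measurableT_comp => //; apply: measurable_funTS.
    by apply: continuous_measurable_fun; exact: continuous_horner.
  - by apply: emeasurable_sum => r; exact: measurable_shell.
rewrite ge0_integral_sum//; last 2 first.
- by move=> r; exact: measurable_shell.
- by move=> r y _; exact: shell_ge0.
apply: (@le_trans _ _ (\sum_(r <- rs) (C * rpw l (1 + m%:R * x))%:E)%E).
  by apply: lee_sum => r _; exact: HC.
rewrite sumEFin lee_fin big_const_seq count_predT srs iter_addr_0.
by rewrite -mulrA [leRHS]mulr_natl.
Qed.

End MonicPolynomialIntegral.

(** * Integration on a square *)

Section Plane.
Context {R : realType}.
Local Notation plane := (measurableTypeR R * measurableTypeR R)%type.
Implicit Types (f F : plane -> R) (r : R).

(** The product sigma-algebra is generated by rectangles, so an open set is written as the countable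
    union of the boxes with rational centre and radius [1 / (n + 1)] that it contains. *)
Lemma open_measurable2 (U : set (R * R)) : open U -> measurable (U : set plane).
Proof.
move=> oU.
pose B (a b : rat) (n : nat) : set (R * R) :=
  ball (ratr a : R) n.+1%:R^-1 `*` ball (ratr b : R) n.+1%:R^-1.
pose F a b n : set plane := if pselect (B a b n `<=` U) then B a b n else set0.
have -> : U = \bigcup_a \bigcup_b \bigcup_n F a b n.
  apply/seteqP; split => [[x y] Uxy|p [a _ [b _ [n _]]]]; last first.
    by rewrite /F; case: pselect => // h /h.
  have /nbhs_ballP[e /= e0 eU] := open_nbhs_nbhs (conj oU Uxy).
  have e20 : 0 < e / 2 by rewrite divr_gt0.
  have [n] := ltr_add_invr e20; rewrite add0r => ne.
  have ne2 : n.+1%:R^-1 + n.+1%:R^-1 <= e.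
    by rewrite [leRHS]splitr lerD// ltW.
  have n0 : 0 < n.+1%:R^-1 :> R by rewrite invr_gt0.
  have near (t : R) : exists a : rat, ball (ratr a : R) n.+1%:R^-1 t.
    have /rat_in_itvoo[a] : t - n.+1%:R^-1 < t + n.+1%:R^-1.
      by rewrite ltrBlDr -addrA ltrDl addr_gt0.
    rewrite in_itv/= => h; exists a.
    rewrite -ball_normE/= ltr_norml; move: h => /andP[h1 h2].
    by move: (ratr a : R) (n.+1%:R^-1 : R) h1 h2 => q d h1 h2; apply/andP; split; lra.
  have [a ax] := near x; have [b yb] := near y.
  exists a => //; exists b => //; exists n => //; rewrite /F.
  case: pselect => [h|[]]; first by split.
  move=> [x' y'] [/= x'a y'b]; apply: eU; split => /=.
    apply: (@le_ball _ _ _ (n.+1%:R^-1 + n.+1%:R^-1)) => //.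
    by apply: ball_triangle x'a; exact: ball_sym.
  apply: (@le_ball _ _ _ (n.+1%:R^-1 + n.+1%:R^-1)) => //.
  by apply: ball_triangle y'b; exact: ball_sym.
apply: bigcupT_measurable_rat => a; apply: bigcupT_measurable_rat => b.
apply: bigcupT_measurable => n; rewrite /F; case: pselect => [h|h]; last exact: measurable0.
by apply: measurableX; apply: measurable_ball.
Qed.

Lemma continuous_measurable2 (U : set (R * R)) (f : R * R -> R) : open U ->
  (forall p, U p -> {for p, continuous f}) ->
  measurable_fun (U : set plane) (f : plane -> R).
Proof.
move=> oU cf; apply: (measurability _ (RGenOInfty.measurableE R)).
move=> /= _ [_ [a ->]] <-; apply: open_measurable2.
rewrite openE => p [Up fp]; have := cf p Up.
move=> /(_ `]a, +oo[%classic) h.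
have ha : nbhs (f p) (`]a, +oo[%classic : set R).
  by apply: open_nbhs_nbhs; split; [exact: rray_open|].
have hU := open_nbhs_nbhs (conj oU Up).
by apply: filterI hU _; exact: h.
Qed.

Definition sq r : set (R * R) := `[0, r]%classic `*` `[0, r]%classic.

Lemma sqP r p : sq r p <-> (0 <= p.1 <= r) /\ (0 <= p.2 <= r).
Proof. by rewrite /sq/= !in_itv. Qed.

Lemma measurable_sq r : measurable (sq r : set plane).
Proof. by apply: measurableX; exact: measurable_itv. Qed.

Let lebesgue_itv r : 0 <= r -> @lebesgue_measure R (`[0, r]%classic) = r%:E.
Proof.
move=> r0; rewrite lebesgue_measure_itv/= lte_fin oppr0 adde0.
by move: r0; rewrite le_eqVlt => /predU1P[<-|->]; rewrite ?ltxx.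
Qed.

Lemma integral_itv_cst (c r : R) : 0 <= r ->
  (\int[@lebesgue_measure R]_(x in `[0%R, r]%classic) c%:E = (c * r)%:E)%E.
Proof.
move=> r0; transitivity (c%:E * @lebesgue_measure R (`[0%R, r]%classic))%E.
  by rewrite integral_cst.
by rewrite lebesgue_itv.
Qed.

Lemma integrable_sq f (C r : R) : 0 <= r -> measurable_fun (sq r : set plane) f ->
  (forall p, sq r p -> 0 <= f p) ->
  (forall x, 0 <= x <= r ->
    (\int[@lebesgue_measure R]_(y in `[0%R, r]%classic) (f (x, y))%:E <= C%:E)%E) ->
  lebesgue2.-integrable (sq r) (EFin \o f).
Proof.
move=> r0 mf f0 fC; apply/integrableP; split; first exact/measurable_EFinP.
rewrite integral_mkcond.
have mF : measurable_fun setT (((abse \o (EFin \o f)) \_ (sq r : set plane)) : plane -> \bar R).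
  apply/(measurable_restrictT _ (measurable_sq r)).
  by apply: measurableT_comp => //; exact/measurable_EFinP.
rewrite /lebesgue2 fubini_tonelli1//; last by move=> p; apply: erestrict_ge0.
apply: (@le_lt_trans _ _ (\int[@lebesgue_measure R]_(x in `[0%R, r]%classic) C%:E)%E); last first.
  by rewrite integral_itv_cst// ltey.
rewrite [leRHS]integral_mkcond; apply: ge0_le_integral => //.
- move=> x _; apply: integral_ge0 => y _; exact: erestrict_ge0.
- by apply: measurable_fun_fubini_tonelli_F => // p; exact: erestrict_ge0.
- by apply/(measurable_restrictT _ (measurable_itv _)).
move=> x _; rewrite /fubini_F [leRHS]patchE; case: ifPn => [|xr].
  rewrite inE/= in_itv/= => xr; apply: le_trans (fC x xr).
  rewrite [leRHS]integral_mkcond le_eqVlt; apply/orP; left; apply/eqP.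
  apply: eq_integral => y _; rewrite !patchE.
  have -> : ((x, y) \in (sq r : set plane)) = (y \in `[0, r]%classic).
    by apply/idP/idP => /set_mem h; apply/mem_set; [case: h|split => //=; rewrite in_itv].
  case: ifPn => //; rewrite inE/= => yr; rewrite ger0_norm//.
  by apply: f0; split => //=; rewrite in_itv.
rewrite le_eqVlt; apply/orP; left; apply/eqP.
rewrite (_ : (fun y => _) = cst 0%E) ?integral0//; apply/funext => y.
rewrite patchE memNset// => -[/= h _]; move: xr; rewrite notin_setE/=; exact.
Qed.

Lemma integrable_sq_bounded f (C r : R) : 0 <= r ->
  measurable_fun (sq r : set plane) f -> (forall p, sq r p -> `|f p| <= C) ->
  lebesgue2.-integrable (sq r) (EFin \o f).
Proof.
move=> r0 mf fC.
have iC : lebesgue2.-integrable (sq r) (EFin \o (cst `|C|)).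
  apply: (@integrable_sq _ (`|C| * r) r) => // x _.
  by rewrite integral_itv_cst.
apply: le_integrable iC => //; first exact: measurable_sq.
  exact/measurable_EFinP.
by move=> p /fC h; rewrite lee_fin/= normr_id; apply: le_trans h (ler_norm _).
Qed.

(** Fubini with [x] as the inner variable, then the fundamental theorem of calculus on each slice.
    Derivability is asked on the open interval only: at [x = 0] a complex power is merely
    continuous. *)
Lemma integral_sq_derive0 (F f : R * R -> R) r : 0 < r ->
  lebesgue2.-integrable (sq r) (EFin \o f) ->
  (forall y, 0 <= y <= r -> F (0, y) = 0 /\ F (r, y) = 0) ->
  (forall x y, 0 <= x <= r -> 0 <= y <= r ->
     {for x, continuous (fun x => F (x, y))} /\
     {for x, continuous (fun x => f (x, y))}) ->
  (forall x y, 0 < x < r -> 0 <= y <= r ->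
     is_derive x 1 (fun x => F (x, y)) (f (x, y))) ->
  \int[lebesgue2]_(p in sq r) f p = 0.
Proof.
move=> r0 fi F0 cF dF; rewrite /Rintegral integral_mkcond.
have fi' : lebesgue2.-integrable setT ((EFin \o f) \_ (sq r : set plane)).
  by apply/(integrable_mkcond _ (measurable_sq r)).
rewrite /lebesgue2 -(integral21_prod_meas1 fi').
rewrite (_ : fubini_G _ _ = cst 0%E) ?integral0//; apply/funext => y.
rewrite /fubini_G; have [yr|yr] := boolP (0 <= y <= r); last first.
  rewrite (_ : (fun x => _) = cst 0%E) ?integral0//; apply/funext => x.
  by rewrite patchE memNset// => -[] _ /=; rewrite in_itv/=; apply/negP.
transitivity (\int[@lebesgue_measure R]_(x in `[0%R, r]%classic) (f (x, y))%:E)%E.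
  rewrite [RHS]integral_mkcond; apply: eq_integral => x _; rewrite !patchE.
  have -> : ((x, y) \in (sq r : set plane)) = (x \in `[0, r]%classic).
    by apply/idP/idP => /set_mem h; apply/mem_set; [case: h|split => //=; rewrite in_itv].
  by [].
have io x : x \in `]0, r[%R -> 0 <= x <= r.
  by rewrite in_itv/= => /andP[/ltW-> /ltW->].
rewrite (@continuous_FTC2 _ (fun x => f (x, y)) (fun x => F (x, y)))//.
- by have [-> ->] := F0 y yr; rewrite subee.
- apply/continuous_in_subspaceT => x; rewrite inE/= in_itv/= => xr.
  exact: (cF x y xr yr).2.
- split.
  + move=> x xr; have := dF x y; rewrite in_itv/= in xr.
    by move=> /(_ xr yr) h; exact: ex_derive.
  + apply: cvg_at_right_filter; apply: (cF 0 y _ yr).1.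
    by rewrite lexx ltW.
  + apply: cvg_at_left_filter; apply: (cF r y _ yr).1.
    by rewrite lexx ltW.
- move=> x; rewrite in_itv/= => xr; rewrite derive1E.
  by have h := dF x y xr yr; rewrite derive_val.
Qed.

Lemma continuous_sq_bounded (U : set (R * R)) (f : R * R -> R) r :
  sq r `<=` U -> (forall p, U p -> {for p, continuous f}) ->
  exists2 C, 0 <= C & forall p, sq r p -> `|f p| <= C.
Proof.
move=> rU cf.
have cs : compact (sq r) by apply: compact_setX; exact: segment_compact.
have : compact (f @` sq r).
  apply: continuous_compact => //; apply/continuous_in_subspaceT => p.
  by rewrite inE => /rU; exact: cf.
move=> /compact_bounded[M [_ HM]]; exists (`|M| + 1); first by rewrite addr_ge0.
move=> p pr; apply: (HM (`|M| + 1)); last by exists p.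
by rewrite ltr_pwDr// ler_norm.
Qed.

End Plane.

(** * Smoothness in the first variable *)

Section PolynomialEstimate.
Context {R : realType}.
Local Notation plane := (measurableTypeR R * measurableTypeR R)%type.

(** By [monic_integral_le] the slice at [x] contributes at most a constant times
    [h x * (l x) ^ (1 + m x0)], which is bounded by assumption; Tonelli concludes. Here [l] is the
    width of the region where [f] lives and [h] the weight in front of the polynomial. *)
Lemma integrable_sq_poly (m : nat) (x0 r C : R) (p : R -> {poly R})
    (l h : R -> R) (f : plane -> R) :
  (0 < m)%N -> - m%:R^-1 < x0 -> x0 <= 0 -> 0 <= r ->
  (forall x, p x \is monic) -> (forall x, size (p x) = m.+1) ->
  measurable_fun (sq r : set plane) f ->
  (forall q, sq r q -> 0 <= f q) ->
  (forall x y, sq r (x, y) -> f (x, y) != 0 ->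
     [/\ 0 < l x, 0 <= h x, h x * rpw (l x) (1 + m%:R * x0) <= C,
       y <= l x & f (x, y) <= h x * rpw `|(p x).[y]| x0]) ->
  lebesgue2.-integrable (sq r) (EFin \o f).
Proof.
move=> m0 x1 x2 r0 mp sp mf f0 fh.
have [K K0 HK] := monic_integral_le m0 x1 x2.
apply: (@integrable_sq _ _ (`|K * C|) r) => // x xr.
(* The bounds are assumed only where [f] is nonzero, so a slice on which [f] vanishes, such as
   [x = 0], says nothing about [l x] and [h x]. *)
have [fx0|/existsNP[y0 /not_implyP[y0r /eqP fy0]]] :=
    pselect (forall y, 0 <= y <= r -> f (x, y) = 0).
  apply: (@le_trans _ _ 0%E); last by rewrite lee_fin.
  rewrite integral0_eq// => y; rewrite /= in_itv/= => yr.
  by rewrite fx0.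
have sxy y : 0 <= y <= r -> sq r (x, y) by move=> yr; apply/sqP.
have [lx hx hC _ _] := fh x y0 (sxy _ y0r) fy0.
have mr (c : R) : measurable (`[0, c]%classic : set R) by exact: measurable_itv.
have mP (D : set R) : measurable D ->
    measurable_fun D (fun y => (rpw `|(p x).[y]| x0)%:E).
  move=> mD; apply/measurable_EFinP; apply: (measurableT_comp (measurable_rpw x0)).
  apply: measurableT_comp => //; apply: measurable_funTS.
  by apply: continuous_measurable_fun; exact: continuous_horner.
have mhP (D : set R) : measurable D ->
    measurable_fun D (fun y => (h x * rpw `|(p x).[y]| x0)%:E).
  by move=> mD; under eq_fun do rewrite EFinM; apply: measurable_funeM; exact: mP.
have mfx : measurable_fun (`[0, r]%classic : set R) (fun y => (f (x, y))%:E).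
  apply/measurable_EFinP.
  have mF : measurable_fun setT (f \_ (sq r : set plane)).
    exact/(measurable_restrictT _ (@measurable_sq R r)).
  have := measurableT_comp mF (pair1_measurable (x : measurableTypeR R)).
  move=> /(@measurable_funTS _ _ _ _ (`[0, r]%classic)); apply: eq_measurable_fun => y.
  rewrite inE/= in_itv/= => yr; rewrite patchE mem_set//; exact: sxy.
apply: (@le_trans _ _ (\int[@lebesgue_measure R]_(y in `[0%R, r]%classic)
   (((fun y => (h x * rpw `|(p x).[y]| x0)%:E) \_ `[0%R, l x]%classic) y))%E).
  apply: ge0_le_integral => //.
  - by move=> y; rewrite /= in_itv/= => yr; rewrite lee_fin f0//; exact: sxy.
  - apply: measurable_funTS; apply/(measurable_restrictT _ (mr _)); exact: mhP.
  move=> y; rewrite /= in_itv/= => yr; have [fy|fy] := eqVneq (f (x, y)) 0.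
    by rewrite fy; apply: erestrict_ge0 => z _; rewrite lee_fin mulr_ge0 ?rpw_ge0.
  have [_ _ _ yl fle] := fh x y (sxy y yr) fy.
  rewrite patchE mem_set ?lee_fin//= in_itv/= yl andbT.
  by case/andP: yr.
apply: (@le_trans _ _ (\int[@lebesgue_measure R]_(y in `[0%R, l x]%classic)
    (h x * rpw `|(p x).[y]| x0)%:E)%E).
  rewrite [leRHS]integral_mkcond; apply: ge0_subset_integral => //.
  - by apply/(measurable_restrictT _ (mr _)); exact: mhP.
  - by move=> y _; apply: erestrict_ge0 => z _; rewrite lee_fin mulr_ge0 ?rpw_ge0.
under eq_integral do rewrite EFinM.
rewrite ge0_integralZl_EFin//; last 2 first.
- by move=> y _; rewrite lee_fin rpw_ge0.
- exact: mP.
apply: (@le_trans _ _ ((h x)%:E * (K * rpw (l x) (1 + m%:R * x0))%:E)%E).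
  by apply: lee_wpmul2l; [rewrite lee_fin|exact: HK].
rewrite -EFinM lee_fin mulrCA; apply: le_trans (ler_norm _) _.
rewrite !normrM ler_wpM2l// (@ger0_norm _ (h x))//.
rewrite ger0_norm ?rpw_ge0//; exact: le_trans hC (ler_norm _).
Qed.

Lemma integrable_sq_rpw_pos (t g : R * R -> R) (x r T G : R) : 0 <= r -> 0 <= x ->
  measurable_fun (sq r : set plane) (t : plane -> R) ->
  measurable_fun (sq r : set plane) (g : plane -> R) ->
  (forall q, sq r q -> t q <= T) -> (forall q, sq r q -> `|g q| <= G) ->
  lebesgue2.-integrable (sq r) (EFin \o (fun q => rpw (t q) x * `|g q|)).
Proof.
move=> r0 x0 mt mg tT gG.
apply: (@integrable_sq_bounded _ _ (rpw T x * G) r) => //.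
  apply: measurable_funM; first exact: (measurableT_comp (measurable_rpw x)).
  exact: measurableT_comp.
move=> q qr; rewrite ger0_norm ?mulr_ge0 ?rpw_ge0//.
rewrite ler_pM ?rpw_ge0 ?gG//; have [t0|t0] := ltP 0 (t q).
  by apply: rpw_ndecr => //; exact: tT.
by rewrite {1}/rpw ltNge t0/= rpw_ge0.
Qed.

End PolynomialEstimate.

(** * Algebra of functions differentiable in [x] *)

Section XSmooth.
Context {R : realType}.
Variable U : set (R * R).
Hypothesis oU : open U.
Implicit Types f g : R * R -> R.

Definition xderiv f f' : Prop := forall p, U p ->
  is_derive p.1 1 (fun x => f (x, p.2)) (f' p).

Definition cont_on f : Prop := forall p, U p -> {for p, continuous f}.

(* Differentiability in the first variable only: integrating by parts in [x]
   never differentiates in [y]. *)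
Fixpoint xsmooth (n : nat) f : Prop :=
  cont_on f /\
  if n is n'.+1 then exists f', xderiv f f' /\ xsmooth n' f' else True.

Lemma xsmooth_cont n f : xsmooth n f -> cont_on f.
Proof. by case: n => [|n] []. Qed.

Lemma xsmoothW n f : xsmooth n.+1 f -> xsmooth n f.
Proof.
elim: n f => [|n IH] f [cf [f' [df sf']]]; first by split.
by split => //; exists f'; split => //; exact: IH.
Qed.

Lemma xsmooth_cst n c : xsmooth n (fun=> c).
Proof.
elim: n c => [|n IH] c; split => //; try by move=> p _; exact: cst_continuous.
by exists (fun=> 0); split => // p _; exact: is_derive_cst.
Qed.

Lemma xsmoothD n f g : xsmooth n f -> xsmooth n g -> xsmooth n (fun p => f p + g p).
Proof.
have cD f1 g1 : cont_on f1 -> cont_on g1 -> cont_on (fun p => f1 p + g1 p).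
  by move=> cf cg p Up; apply: cvgD; [exact: cf|exact: cg].
elim: n f g => [|n IH] f g.
  by move=> [cf _] [cg _]; split => //; exact: cD.
move=> [cf [f' [df sf']]] [cg [g' [dg sg']]]; split; first exact: cD.
exists (fun p => f' p + g' p); split; last exact: IH.
by move=> p Up; have := df p Up; have := dg p Up => ? ?; exact: is_deriveD.
Qed.

Lemma xsmoothM n f g : xsmooth n f -> xsmooth n g -> xsmooth n (fun p => f p * g p).
Proof.
have cM f1 g1 : cont_on f1 -> cont_on g1 -> cont_on (fun p => f1 p * g1 p).
  by move=> cf cg p Up; apply: cvgM; [exact: cf|exact: cg].
elim: n f g => [|n IH] f g.
  by move=> [cf _] [cg _]; split => //; exact: cM.
move=> sf sg; have wf := xsmoothW sf; have wg := xsmoothW sg.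
case: sf => [cf [f' [df sf']]]; case: sg => [cg [g' [dg sg']]]; split; first exact: cM.
exists (fun p => f p * g' p + f' p * g p); split.
  move=> p Up; have := df p Up; have := dg p Up => dgp dfp.
  by apply: is_derive_eq; rewrite /GRing.scale/= -!surjective_pairing; ring.
by apply: xsmoothD; exact: IH.
Qed.

Lemma xsmoothV n f : (forall p, U p -> f p != 0) -> xsmooth n f ->
  xsmooth n (fun p => (f p)^-1).
Proof.
move=> f0; have cV : cont_on f -> cont_on (fun p => (f p)^-1).
  by move=> cf p Up; apply: cvgV; [exact: f0|exact: cf].
elim: n => [|n IH] sf; first by case: sf => cf _; split => //; exact: cV.
have wf := IH (xsmoothW sf).
case: sf => [cf [f' [df sf']]]; split; first exact: cV.
exists (fun p => -1 * (f' p * ((f p)^-1 * (f p)^-1))); split.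
  move=> p Up; have := df p Up => dfp.
  have fp : f (p.1, p.2) != 0 by rewrite -surjective_pairing f0.
  apply: (@is_derive_eq _ _ _ _ _ _ _ _ (is_deriveV fp dfp)).
  by rewrite /GRing.scale/= -surjective_pairing expr2 invfM; ring.
apply: xsmoothM; first exact: xsmooth_cst.
by apply: xsmoothM => //; exact: xsmoothM.
Qed.

Lemma smooth_on_xsmooth f n : smooth_on U f -> xsmooth n f.
Proof.
move=> sf; rewrite (_ : f = partials [::] f)//.
have : all (fun d => ~~ d) [::] by [].
move: [::] => ds; elim: n ds => [|n IH] ds dsf.
  by split => // p Up; exact: (sf ds p Up).1.
split; first by move=> p Up; exact: (sf ds p Up).1.
exists (partials (false :: ds) f); split; last exact: IH.
move=> [x y] /= Up; have [_ /(_ false)] := sf ds _ Up.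
rewrite /derivable /=.
set F := partials ds f => dF.
have E : (fun h : R => h^-1 *: ((F \o shift (x, y)) (h *: ((1, 0) : R * R)) - F (x, y))) =
    (fun h : R => h^-1 *: (((fun x => F (x, y)) \o shift x) (h *: (1 : R)) - F (x, y))).
  apply/funext => h /=; congr (_ *: (F _ - _)).
  by congr pair; rewrite /= /GRing.scale/= ?mulr1 ?mulr0 ?add0r.
apply: DeriveDef; first by rewrite /derivable -E.
by rewrite /derive -E.
Qed.

End XSmooth.

(** * Integration by parts *)

Section Flat.
Context {R : realType}.

(** Induction on [K] for all derivatives at once: the mean value theorem from 0 turns the bound of
    order [K] for the next derivative into one of order [K + 1]. The case [K = 0] is compactness. *)
Lemma flat_le (e : R -> R) (r : R) (K : nat) : 0 <= r ->
  (forall x, 0 <= x <= r -> forall n, derivable (derive1n n e) x 1) ->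
  flat_at0 e -> exists2 C : R, 0 <= C & forall x, 0 <= x <= r -> `|e x| <= C * x ^+ K.
Proof.
move=> r0 de fe; rewrite (_ : e = derive1n 0 e)//; move: (0%N) => n.
elim: K n => [|K IH] n.
  have cs : compact (`[0, r]%classic : set R) by exact: segment_compact.
  have : compact (derive1n n e @` `[0, r]%classic).
    apply: continuous_compact => //; apply/continuous_in_subspaceT => x.
    rewrite inE/= in_itv/= => xr.
    by apply/differentiable_continuous/derivable1_diffP; exact: de.
  move=> /compact_bounded[M [_ HM]]; exists (`|M| + 1); first by rewrite addr_ge0.
  move=> x xr; rewrite expr0 mulr1; apply: (HM (`|M| + 1)).
    by rewrite ltr_pwDr// ler_norm.
  by exists x => //=; rewrite in_itv.
have [C C0 HC] := IH n.+1; exists C => // x /andP[x0 xr].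
have [c c0x E] : exists2 c, c \in `[0, x]%R &
    derive1n n e x - derive1n n e 0 = derive1n n.+1 e c * (x - 0).
  apply: MVT_segment => // [c|].
    rewrite in_itv/= => /andP[c0 cx].
    rewrite derive1E; apply: derivableP; apply: de.
    by rewrite ltW// (le_trans (ltW cx) xr).
  apply: derivable_within_continuous => c; rewrite in_itv/= => /andP[c0 cx].
  by apply: de; rewrite c0 (le_trans cx xr).
move: E; rewrite fe !subr0 => ->; rewrite normrM (ger0_norm x0) exprSr mulrA.
move: c0x; rewrite in_itv/= => /andP[c0 cx].
rewrite ler_wpM2r//; apply: le_trans (HC c _) _; first by rewrite c0 (le_trans cx xr).
by rewrite ler_wpM2l// lerXn2r// nnegrE.
Qed.

End Flat.

(** * Complex-valued functions of one real variable *)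

Section ComplexSlices.
Context {R : realType}.
Implicit Types (F G : R -> R[i]).

Lemma cder_near F G (F' : R[i]) (x : R) : {near x, F =1 G} -> cder F F' x -> cder G F' x.
Proof.
move=> FG [d1 d2]; split.
  by apply: (near_eq_is_derive _ d1) => //; apply: filterS FG => t ->.
by apply: (near_eq_is_derive _ d2) => //; apply: filterS FG => t ->.
Qed.

Definition ccont F (x : R) : Prop :=
  (Re (F t) @[t --> x] --> Re (F x)) /\ (Im (F t) @[t --> x] --> Im (F x)).

Lemma cder_ccont F (F' : R[i]) (x : R) : cder F F' x -> ccont F x.
Proof.
move=> [d1 d2]; split; apply/differentiable_continuous/derivable1_diffP.
  exact: ex_derive.
exact: ex_derive.
Qed.

Lemma ccontD F G x : ccont F x -> ccont G x -> ccont (fun t => F t + G t) x.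
Proof.
move=> [F1 F2] [G1 G2]; split.
  by rewrite ReD; under eq_fun do rewrite ReD; exact: cvgD.
by rewrite ImD; under eq_fun do rewrite ImD; exact: cvgD.
Qed.

Lemma ccontM F G x : ccont F x -> ccont G x -> ccont (fun t => F t * G t) x.
Proof.
move=> [F1 F2] [G1 G2]; split.
  by rewrite ReM; under eq_fun do rewrite ReM; apply: cvgB; exact: cvgM.
by rewrite ImM; under eq_fun do rewrite ImM; apply: cvgD; exact: cvgM.
Qed.

Lemma ccont_cst c x : ccont (fun=> c) x.
Proof. by split; exact: cst_continuous. Qed.

Lemma ccont_real (f : R -> R) (x : R) : {for x, continuous f} ->
  ccont (fun t => (f t)%:C) x.
Proof. by move=> cf; split => //=; exact: cst_continuous. Qed.

Lemma cder_cpw (t : R -> R) (t' x : R) (s : R[i]) : 0 < t x -> is_derive x 1 t t' ->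
  cder (fun y => cpw (t y) s) (s * (t' / t x)%:C * cpw (t x) s) x.
Proof.
move=> tx dt.
have ct : {for x, continuous t}.
  by apply/differentiable_continuous/derivable1_diffP; exact: ex_derive.
have nt : \forall y \near x, 0 < t y by exact: (cvgr_gt _ ct _ tx).
apply: (@cder_near (fun y => cexp (s * (ln (t y))%:C))).
  by apply: filterS nt => y ty; rewrite /cpw ty.
have dl : is_derive x 1 (fun y => ln (t y)) (t' / t x).
  have dln := is_derive1_ln tx.
  have := @is_derive1_comp _ (@ln R) t x _ _ dln dt.
  by move=> h; apply: is_derive_eq; rewrite /GRing.scale/= mulrC.
have := cder_cexp (cderM (cder_cst s x) (cder_real dl)).
by rewrite /cpw tx => h; apply: cder_eq h _; ring.
Qed.

(** Only [t = 0] is delicate: there [t ^ Re s] is below [e] once [t] is below [e ^ (1 / Re s)], the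
    number [d] of the proof. *)
Lemma ccont_cpw (s : R[i]) (x : R) : 0 < Re s -> ccont (fun t => cpw t s) x.
Proof.
move=> s0; have [x0|x0|->] := ltgtP x 0.
- have n0 : {near x, (fun=> 0) =1 (fun t : R => cpw t s)}.
    have : \forall t \near x, t < 0.
      by apply: (@open_nbhs_nbhs _ x [set t | t < 0]); split => //; exact: open_lt.
    by apply: filterS => t t0; rewrite /cpw ltNge (ltW t0).
  exact: cder_ccont (cder_near n0 (cder_cst 0 x)).
- exact: cder_ccont (cder_cpw s x0 (is_derive_id x 1)).
have key (e : R) : 0 < e -> \forall t \near (0 : R), nrm (cpw t s) <= e.
  move=> e0; set d := expR (ln e / Re s); have d0 : 0 < d by exact: expR_gt0.
  apply/nbhs_ballP; exists d => //= t; rewrite -ball_normE/= sub0r normrN => td.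
  rewrite nrm_cpw /rpw; case: ifP => t0; last exact: ltW.
  rewrite -[leRHS]lnK// ler_expR -ler_pdivlMl// -ler_expR lnK// mulrC.
  by apply: ltW; move: td; rewrite gtr0_norm.
have c0 : cpw 0 s = 0 by rewrite /cpw ltxx.
split; apply/cvgrPdist_le => e e0; rewrite c0/=; apply: filterS (key e e0) => t h.
  by rewrite sub0r normrN; apply: le_trans (Re_le_nrm _) h.
by rewrite sub0r normrN; apply: le_trans (Im_le_nrm _) h.
Qed.

End ComplexSlices.

Lemma is_derive_exprn {R : realType} (x : R) n :
  is_derive x 1 (fun x => x ^+ n) (n%:R * x ^+ n.-1).
Proof.
elim: n => [|n IH].
  under eq_fun do rewrite expr0; rewrite mul0r; exact: is_derive_cst.
under eq_fun do rewrite exprS.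
apply: is_derive_eq; rewrite /GRing.scale/= -natr1.
by case: n {IH} => [|n]; rewrite ?exprS; ring.
Qed.

Section ByParts.
Context {R : realType}.
Local Notation plane := (measurableTypeR R * measurableTypeR R)%type.
Variables (a m : nat) (r : R) (U : set (R * R)) (v vx : R * R -> R).
Hypotheses (m_gt0 : (0 < m)%N) (r0 : 0 < r) (oU : open U) (rU : sq r `<=` U).
Hypotheses (v0 : forall p, U p -> 0 < v p) (cv : cont_on U v) (cvx : cont_on U vx).
Hypothesis dv : xderiv U v vx.
Implicit Types w : R * R -> R.

Definition monomial p : R := p.1 ^+ a * p.2 ^+ m * v p.

(** Vanishing is required near [x = r], not only at [x = r], so that it passes to the
    [x]-derivatives. *)
Definition vanish_at_edge w : Prop :=
  forall y, 0 <= y <= r -> \forall x \near r, w (x, y) = 0.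

Definition zetaJ k w (s : R[i]) : R[i] :=
  cint lebesgue2 (sq r) (fun p => cpw (monomial p) s * (p.1 ^+ k * w p)%:C).

Lemma cont_on_measurable w : cont_on U w -> measurable_fun (sq r : set plane) (w : plane -> R).
Proof.
move=> cw; apply: measurable_funS (continuous_measurable2 oU cw) => //.
exact: open_measurable2.
Qed.

Lemma cont_on_mul w w' : cont_on U w -> cont_on U w' -> cont_on U (fun p => w p * w' p).
Proof. by move=> cw cw' p Up; apply: cvgM; [exact: cw|exact: cw']. Qed.

Lemma cont_on_fstX k : cont_on U (fun p => p.1 ^+ k).
Proof.
move=> p _; apply: (@continuous_comp _ _ _ fst (fun x : R => x ^+ k)).
  exact: cvg_fst.
exact: exprn_continuous.
Qed.

Lemma cont_on_sndX k : cont_on U (fun p => p.2 ^+ k).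
Proof.
move=> p _; apply: (@continuous_comp _ _ _ snd (fun x : R => x ^+ k)).
  exact: cvg_snd.
exact: exprn_continuous.
Qed.

Lemma cont_on_monomial : cont_on U monomial.
Proof.
apply: cont_on_mul => //.
by apply: cont_on_mul; [exact: cont_on_fstX|exact: cont_on_sndX].
Qed.

Lemma continuous_pairl (x y : R) : {for x, continuous (fun x : R => (x, y))}.
Proof.
move=> A [[P Q] /= [Px Qy] PQ]; apply: filterS Px => z Pz.
by apply: PQ; split => //=; exact: nbhs_singleton Qy.
Qed.

Lemma cont_on_slice w x y : cont_on U w -> U (x, y) ->
  {for x, continuous (fun x => w (x, y))}.
Proof.
move=> cw Uxy; apply: (@continuous_comp _ _ _ (fun x => (x, y)) w); last exact: cw.
exact: continuous_pairl.
Qed.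

Lemma vanish_at_edge_deriv w w' : xderiv U w w' -> vanish_at_edge w ->
  vanish_at_edge w'.
Proof.
move=> dw ww y yr.
have Ur : U (r, y) by apply: rU; apply/sqP; rewrite lexx ltW.
have nU : \forall x \near r, U (x, y).
  have c := @continuous_pairl r y.
    exact: (c U (open_nbhs_nbhs (conj oU Ur))).
have nn := nbhs_interior (ww y yr).
apply: filterS2 nn nU => x wx Ux.
have d1 := dw (x, y) Ux.
have d0 : is_derive x 1 (fun x => w (x, y)) 0.
  apply: (@near_eq_is_derive _ _ _ (fun=> 0)) => //.
  by apply: filterS wx => z ->.
by rewrite -(@derive_val _ _ _ _ _ _ _ d1) (@derive_val _ _ _ _ _ _ _ d0).
Qed.

Lemma cinte_zetaJ k w s : 0 < Re s -> cont_on U w ->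
  cinte lebesgue2 (sq r) (fun p => cpw (monomial p) s * (p.1 ^+ k * w p)%:C).
Proof.
move=> s0 cw.
have cg : cont_on U (fun p => p.1 ^+ k * w p).
  by apply: cont_on_mul => //; exact: cont_on_fstX.
have [T _ HT] := continuous_sq_bounded rU cont_on_monomial.
have [G _ HG] := continuous_sq_bounded rU cg.
have i : lebesgue2.-integrable (sq r)
    (EFin \o (fun q => rpw (monomial q) (Re s) * `|q.1 ^+ k * w q|)).
  apply: (integrable_sq_rpw_pos (ltW r0) (ltW s0) _ _ _ HG) => //.
  - exact: cont_on_measurable cont_on_monomial.
  - exact: cont_on_measurable cg.
  - by move=> q qr; apply: le_trans (HT q qr); exact: ler_norm.
apply: (@cinte_power _ _ _ lebesgue2 _ _ monomial _ (Re s) (Re s)) => //.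
- exact: measurable_sq.
- exact: cont_on_measurable cont_on_monomial.
- exact: cont_on_measurable cg.
Qed.

(* Integration of the [x]-derivative of [monomial ^ s * x ^ k.+1 * w], which
   vanishes on both edges [x = 0] and [x = r]. *)
Lemma zetaJ_parts k w w' s : 0 < Re s ->
  cont_on U w -> cont_on U w' -> xderiv U w w' -> vanish_at_edge w ->
  (a%:R * s + k.+1%:R) * zetaJ k w s =
    - (zetaJ k.+1 w' s + s * zetaJ k.+1 (fun p => vx p / v p * w p) s).
Proof.
move=> s0 cw cw' dw vw.
pose q p := vx p / v p.
have cq : cont_on U q.
  apply: cont_on_mul => // p Up; apply: cvgV; last exact: cv.
  by rewrite gt_eqF// v0.
have cqw : cont_on U (fun p => q p * w p) by exact: cont_on_mul.
(* [K] is the [x]-derivative of [Fc] below: [c1] collects the exponents of [x], and [s * q] comes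
   from the logarithmic derivative [q] of [v]. *)
pose c1 : R[i] := a%:R * s + k.+1%:R.
pose K p := c1 * (cpw (monomial p) s * (p.1 ^+ k * w p)%:C) +
  cpw (monomial p) s * (p.1 ^+ k.+1 * w' p)%:C +
  s * (cpw (monomial p) s * (p.1 ^+ k.+1 * (q p * w p))%:C).
have i1 := cinte_zetaJ k s0 cw.
have i2 := cinte_zetaJ k.+1 s0 cw'.
have i3 := cinte_zetaJ k.+1 s0 cqw.
have mD := @measurable_sq R r.
have iK : cinte lebesgue2 (sq r) K.
  by apply: cinteD; [done|apply: cinteD; [done|exact: cinteZ|]|exact: cinteZ].
have KE : cint lebesgue2 (sq r) K = c1 * zetaJ k w s + zetaJ k.+1 w' s +
    s * zetaJ k.+1 (fun p => q p * w p) s.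
  rewrite cintD//; last 2 first.
  - by apply: cinteD => //; exact: cinteZ.
  - exact: cinteZ.
  rewrite cintD//; last exact: cinteZ.
  by rewrite !cintZ.
suff K0 : cint lebesgue2 (sq r) K = 0.
  by apply/eqP; rewrite -subr_eq0 opprK addrA -KE K0.
pose Fc p := cpw (monomial p) s * (p.1 ^+ k.+1 * w p)%:C.
have Fc0 y : 0 <= y <= r -> Fc (0, y) = 0 /\ Fc (r, y) = 0.
  move=> yr; split; first by rewrite /Fc expr0n mul0r mulr0.
  by rewrite /Fc (nbhs_singleton (vw y yr)) mulr0 mulr0.
have Uxy x y : 0 <= x <= r -> 0 <= y <= r -> U (x, y).
  by move=> xr yr; apply: rU; apply/sqP.
have cm x y : U (x, y) -> ccont (fun x => cpw (monomial (x, y)) s) x.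
  move=> Up; have ct := cont_on_slice cont_on_monomial Up.
  have [c1' c2'] := ccont_cpw (monomial (x, y)) s0; split.
    exact: (@continuous_comp _ _ _ (fun x => monomial (x, y)) (fun t => Re (cpw t s))).
  exact: (@continuous_comp _ _ _ (fun x => monomial (x, y)) (fun t => Im (cpw t s))).
have cr n f x y : U (x, y) -> cont_on U f ->
    ccont (fun x => (x ^+ n * f (x, y))%:C) x.
  move=> Up cf; apply: ccont_real; apply: cvgM; first exact: exprn_continuous.
  exact: cont_on_slice.
have cF x y : U (x, y) -> ccont (fun x => Fc (x, y)) x.
  by move=> Up; apply: ccontM; [exact: cm|exact: cr].
have cK x y : U (x, y) -> ccont (fun x => K (x, y)) x.
  move=> Up; apply: ccontD; [apply: ccontD|].
  - apply: ccontM; first exact: ccont_cst.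
    by apply: ccontM; [exact: cm|exact: cr].
  - by apply: ccontM; [exact: cm|exact: cr].
  - apply: ccontM; first exact: ccont_cst.
    apply: ccontM; first exact: cm.
    exact: (@cr k.+1 (fun p => q p * w p)).
have dF x y : 0 < x < r -> 0 <= y <= r -> cder (fun x => Fc (x, y)) (K (x, y)) x.
  (* On the slice [y = 0] the base of the power is identically 0, since [m > 0], and both sides are
     0; elsewhere the base is positive and the logarithmic derivative makes sense. *)
  move=> /andP[x0 xr] /andP[]; rewrite le_eqVlt => /predU1P[<- _|y0 yr].
    have m0' x' : monomial (x', 0) = 0 by rewrite /monomial/= expr0n gtn_eqF// mulr0 mul0r.
    rewrite /Fc /K; under eq_fun do rewrite m0' /cpw ltxx mul0r.
    apply: cder_eq (cder_cst 0 x) _.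
    by rewrite m0' /cpw ltxx !mul0r !mulr0 !addr0.
  have Up : U (x, y) by apply: Uxy; apply/andP; split => //; exact: ltW.
  have mp : 0 < monomial (x, y) by rewrite /monomial !mulr_gt0 ?exprn_gt0// v0.
  have dvp : is_derive x 1 (fun x => v (x, y)) (vx (x, y)) := dv Up.
  have dwp : is_derive x 1 (fun x => w (x, y)) (w' (x, y)) := dw (x, y) Up.
  pose mm : R := (a%:R * x ^+ a.-1 * y ^+ m) * v (x, y) + x ^+ a * y ^+ m * vx (x, y).
  have dm : is_derive x 1 (fun x => monomial (x, y)) mm.
    have dxa := is_derive_exprn x a.
    rewrite /monomial/=; apply: is_derive_eq; rewrite /GRing.scale/= /mm.
    ring.
  have dxw : is_derive x 1 (fun x => x ^+ k.+1 * w (x, y))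
      (k.+1%:R * x ^+ k * w (x, y) + x ^+ k.+1 * w' (x, y)).
    have dxk := is_derive_exprn x k.+1.
    by apply: is_derive_eq; rewrite /GRing.scale/=; ring.
  have dFc := cderM (@cder_cpw _ (fun x => monomial (x, y)) mm x s mp dm) (cder_real dxw).
  apply: (@cder_eq _ (fun x => Fc (x, y)) _ _ x dFc).
  have mE : mm / monomial (x, y) = a%:R / x + q (x, y).
    have vn : v (x, y) != 0 by rewrite gt_eqF// v0.
    have yn : y != 0 by rewrite gt_eqF.
    have xn : x != 0 by rewrite gt_eqF.
    have : x ^+ a * (a%:R / x) = a%:R * x ^+ a.-1.
      case: (a) => [|a']; first by rewrite !mul0r mulr0.
      by rewrite exprS/=; field.
    rewrite /mm /q /monomial/= => <-; field.
    by rewrite vn xn !expf_neq0.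
  rewrite mE /K /c1 [_.1]/=; move: (q (x, y)) => Q.
  have xn : x%:C != 0 :> R[i] by rewrite -(rmorph0 (real_complex R)) (inj_eq (@complexI R)) gt_eqF.
  rewrite !(rmorphM, rmorphD, rmorphXn, rmorph_nat, fmorphV)/= exprS.
  by field.
(* The vanishing theorem is about real functions; [c = 1] and [c = - 'i] recover the real and the
   imaginary part. *)
have Z (c : R[i]) : Re (c * cint lebesgue2 (sq r) K) = 0.
  rewrite -cintZ//.
  have iZ := cinteZ mD c iK.
  apply: (@integral_sq_derive0 _ (fun p => Re (c * Fc p)) (fun p => Re (c * K p))) => //.
  - exact: iZ.1.
  - by move=> y yr; have [-> ->] := Fc0 y yr; rewrite mulr0.
  - move=> x y xr yr; have Up := Uxy x y xr yr; split.
      exact: (ccontM (ccont_cst c x) (cF x y Up)).1.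
    exact: (ccontM (ccont_cst c x) (cK x y Up)).1.
  - move=> x y xr yr; have h := cderM (cder_cst c x) (dF x y xr yr).
    by rewrite mul0r add0r in h; exact: h.1.
apply: complexP; first by have := Z 1; rewrite mul1r.
have := Z (- 'i%C); rewrite mulNr ReN mulrC ReiNIm opprK => ->.
by [].
Qed.

End ByParts.

(** * The two pieces of the zeta function *)

Section LocalZetaParts.
Context {R : realType}.
Local Notation plane := (measurableTypeR R * measurableTypeR R)%type.
Variables (a m : nat) (r c0 : R) (U : set (R * R)) (v : R * R -> R).
Hypotheses (a_gt0 : (0 < a)%N) (m_gt0 : (0 < m)%N).
Hypotheses (r0 : 0 < r) (r1 : r <= 1) (oU : open U) (rU : sq r `<=` U).
Hypotheses (c00 : 0 < c0) (v0 : forall p, U p -> c0 <= v p) (cv : cont_on U v).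
Implicit Types w : R * R -> R.

Let v_gt0 p : U p -> 0 < v p.
Proof. by move=> /v0; exact: lt_le_trans. Qed.

(** The polynomial is a parameter so that [|G|] (with [pertP]) and its monomial model (with ['X^m])
    share the same estimates. *)
Definition polyT (P : R -> {poly R}) (p : R * R) : R :=
  p.1 ^+ a * `|(P p.1).[p.2]| * v p.

Lemma polyT_Xn p : sq r p -> polyT (fun=> 'X^m) p = monomial a m v p.
Proof.
move=> /sqP[_ /andP[y0 _]].
by rewrite /polyT /monomial hornerXn ger0_norm// exprn_ge0.
Qed.

Lemma polyT_gt0 (P : R -> {poly R}) p : sq r p -> 0 < polyT P p ->
  0 < p.1 /\ 0 < `|(P p.1).[p.2]|.
Proof.
move=> pr; rewrite /polyT pmulr_lgt0; last exact: v_gt0 (rU pr).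
move: pr => /sqP[/andP[x0 _] _].
move: x0; rewrite le_eqVlt => /predU1P[<-|x0].
  by rewrite expr0n gtn_eqF// mul0r ltxx.
by rewrite pmulr_rgt0// exprn_gt0.
Qed.

Lemma rpw_polyT (P : R -> {poly R}) p (x : R) : x <= 0 -> sq r p -> 0 < polyT P p ->
  rpw (polyT P p) x <= rpw c0 x * rpw (p.1 ^+ a) x * rpw `|(P p.1).[p.2]| x.
Proof.
move=> x0 pr T0; have [x_gt0 P_gt0] := polyT_gt0 pr T0.
have vp := v_gt0 (rU pr).
rewrite /polyT rpwM ?mulr_gt0 ?exprn_gt0// rpwM ?exprn_gt0// mulrC.
rewrite mulrA ler_wpM2r ?rpw_ge0// ler_wpM2r ?rpw_ge0//.
by apply: rpw_nincr => //; exact: v0 (rU pr).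
Qed.

Lemma rpw_unit_le1 (t x : R) : 0 < t -> t <= 1 -> -1 <= x -> t * rpw t x <= 1.
Proof.
move=> t0 t1 x1; rewrite /rpw t0 -{1}(lnK (t0 : t \is Num.pos)) -expRD -expR0 ler_expR.
by rewrite -[X in X + _]mul1r -mulrDl; apply: mulr_ge0_le0; [lra|exact: ln_le0].
Qed.

Let fst_bounds p : sq r p -> 0 <= p.1 /\ p.1 <= 1.
Proof. by move=> /sqP[/andP[-> xr] _]; split => //; exact: le_trans r1. Qed.

(* The factor [x ^ a] of [g] absorbs the power [x ^ (a * x0)], [x0 > -1]. *)
Lemma integrable_polyT_monomial (g : plane -> R) (x0 G : R) :
  - m%:R^-1 < x0 -> x0 <= 0 -> 0 <= G ->
  measurable_fun (sq r : set plane) g ->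
  (forall p, sq r p -> `|g p| <= G * p.1 ^+ a) ->
  lebesgue2.-integrable (sq r)
    (EFin \o (fun p => rpw (polyT (fun=> 'X^m) p) x0 * `|g p|)).
Proof.
move=> x1 x2 G0 mg gG.
have x1' : -1 <= x0.
  apply: le_trans (ltW x1); rewrite lerN2 invf_le1 ?ltr0n//.
  by rewrite (ler_nat _ 1).
have cT : cont_on U (polyT (fun=> 'X^m)).
  apply: cont_on_mul => //; apply: cont_on_mul; first exact: cont_on_fstX.
  move=> p Up; apply: (@continuous_comp _ _ _ (fun p : R * R => ('X^m : {poly R}).[p.2]) (fun t => `|t|)).
    have -> : (fun p : R * R => ('X^m : {poly R}).[p.2]) = (fun p => p.2 ^+ m).
      by apply/funext => q; rewrite hornerXn.
    exact: (@cont_on_sndX R U m p Up).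
  exact: norm_continuous.
pose C := rpw c0 x0 * G.
have C0 : 0 <= C by rewrite mulr_ge0 ?rpw_ge0.
apply: (@integrable_sq_poly _ m x0 r (C * rpw r (1 + m%:R * x0)) (fun=> 'X^m)
  (fun=> r) (fun=> C)) => //.
- exact: ltW.
- by move=> _; exact: monicXn.
- by move=> _; rewrite size_polyXn.
- apply: measurable_funM; last exact: measurableT_comp.
  exact: measurableT_comp (measurable_rpw x0) (cont_on_measurable oU rU cT).
- by move=> p _; rewrite mulr_ge0 ?rpw_ge0.
move=> x y xyr; have [T0|T0] := ltP 0 (polyT (fun=> 'X^m) (x, y)); last first.
  by rewrite /rpw ltNge T0/= mul0r eqxx.
have [x_gt0 P_gt0] := polyT_gt0 xyr T0; rewrite /= in x_gt0 P_gt0.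
have [_ xl1] := fst_bounds xyr; rewrite /= in xl1.
move=> _; split => //; first by have /sqP[_ /andP[]] := xyr.
apply: (@le_trans _ _ (rpw c0 x0 * rpw (x ^+ a) x0 * rpw `|('X^m : {poly R}).[y]| x0 *
    (G * x ^+ a))).
  by rewrite ler_pM ?rpw_ge0 ?gG//; exact: rpw_polyT.
rewrite [leLHS](_ : _ = C * rpw `|('X^m : {poly R}).[y]| x0 *
  (x ^+ a * rpw (x ^+ a) x0)); last by rewrite /C; ring.
rewrite ler_piMr ?mulr_ge0 ?rpw_ge0//.
by apply: rpw_unit_le1; rewrite ?exprn_gt0// exprn_ile1// ltW.
Qed.

(* On a flat neighbourhood [y <= B * x ^ M] of the axis each term is integrable
   on its own. *)
Lemma integrable_polyT_flat (P : R -> {poly R}) (M : nat) (g : plane -> R) (x0 B G : R) :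
  - m%:R^-1 < x0 -> x0 <= 0 -> 0 < B -> a%:R <= M%:R * (1 + m%:R * x0) ->
  (forall x, P x \is monic) -> (forall x, size (P x) = m.+1) ->
  measurable_fun (sq r : set plane) (polyT P : plane -> R) ->
  measurable_fun (sq r : set plane) g ->
  (forall p, sq r p -> `|g p| <= G) ->
  (forall p, sq r p -> 0 < p.1 -> g p != 0 -> p.2 <= B * p.1 ^+ M) ->
  lebesgue2.-integrable (sq r) (EFin \o (fun p => rpw (polyT P p) x0 * `|g p|)).
Proof.
move=> x1 x2 B0 HM mP sP mT mg gG gB.
have x1' : -1 <= x0.
  apply: le_trans (ltW x1); rewrite lerN2 invf_le1 ?ltr0n//.
  by rewrite (ler_nat _ 1).
have G0 : 0 <= G by apply: le_trans (gG (0, 0) _) => //; apply/sqP; rewrite /= lexx ltW.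
apply: (@integrable_sq_poly _ m x0 r (rpw c0 x0 * G * rpw B (1 + m%:R * x0)) P
  (fun x => B * x ^+ M) (fun x => rpw c0 x0 * rpw (x ^+ a) x0 * G)) => //.
- exact: ltW.
- apply: measurable_funM; last exact: measurableT_comp.
  exact: measurableT_comp (measurable_rpw x0) mT.
- by move=> p _; rewrite mulr_ge0 ?rpw_ge0.
move=> x y xyr; have [T0|T0] := ltP 0 (polyT P (x, y)); last first.
  by rewrite /rpw ltNge T0/= mul0r eqxx.
have [g0|g0] := eqVneq (g (x, y)) 0; first by rewrite g0 normr0 mulr0 eqxx.
have [x_gt0 P_gt0] := polyT_gt0 xyr T0; rewrite /= in x_gt0 P_gt0.
have [_ xl1] := fst_bounds xyr; rewrite /= in xl1.
move=> _; split.
- by rewrite mulr_gt0// exprn_gt0.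
- by rewrite !mulr_ge0 ?rpw_ge0.
- rewrite rpwM ?exprn_gt0// [leLHS](_ : _ = rpw c0 x0 * G * rpw B (1 + m%:R * x0) *
    (rpw (x ^+ a) x0 * rpw (x ^+ M) (1 + m%:R * x0))); last by ring.
  (* What remains is a power of [x <= 1] with exponent [a x0 + M (1 + m x0)], nonnegative by the
     choice of [M] and [x0 >= -1]. *)
  rewrite ler_piMr ?mulr_ge0 ?rpw_ge0// !rpwX// /rpw x_gt0 -expRD -[leRHS]expR0 ler_expR.
  rewrite -mulrDl mulr_ge0_le0 ?ln_le0//.
  have : - a%:R <= a%:R * x0 by rewrite -mulrN1 ler_wpM2l.
  by lra.
- exact: gB xyr x_gt0 g0.
- rewrite [leRHS](_ : _ = rpw c0 x0 * rpw (x ^+ a) x0 * rpw `|(P x).[y]| x0 * G); last by ring.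
  by rewrite ler_pM ?rpw_ge0 ?gG//; exact: rpw_polyT.
Qed.

(** The two ends are estimated differently: at [x1 <= 0] by the integrals of polynomial powers, at
    [x2 >= 0] by boundedness of the integrand. *)
Lemma strip_exponents (z : R[i]) : - m%:R^-1 < Re z -> exists x1 x2 : R,
  [/\ - m%:R^-1 < x1, x1 <= 0, x1 < Re z, 0 <= x2 & Re z < x2].
Proof.
move=> hz; have m0 : 0 < (m%:R : R)^-1 by rewrite invr_gt0 ltr0n.
have [z0|z0] := leP (Re z) 0.
  by exists ((- m%:R^-1 + Re z) / 2), 1; split => //; lra.
by exists (- m%:R^-1 / 2), (Re z + 1); split; lra.
Qed.

(** With [a <= k] the factor [x ^ k] already absorbs the singularity in [x], so no integration by
    parts is needed. *)
Lemma zetaJ_slope k w (z : R[i]) : cont_on U w -> (a <= k)%N ->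
  - m%:R^-1 < Re z -> slope_derivable (zetaJ a m r v k w) z.
Proof.
move=> cw ak hz; have [x1 [x2 [h1 h2 h3 h4 h5]]] := strip_exponents hz.
have cg : cont_on U (fun p => p.1 ^+ k * w p).
  by apply: cont_on_mul => //; exact: cont_on_fstX.
have ct := @cont_on_monomial _ a m U v cv.
have [T _ HT] := continuous_sq_bounded rU ct.
have [G G0 HG] := continuous_sq_bounded rU cw.
have [G' _ HG'] := continuous_sq_bounded rU cg.
apply: (@cint_power_slope _ _ _ lebesgue2 _ _ (monomial a m v)
  (fun p => p.1 ^+ k * w p) x1 x2) => //.
- exact: measurable_sq.
- exact: cont_on_measurable ct.
- exact: cont_on_measurable cg.
- have := @integrable_polyT_monomial (fun p => p.1 ^+ k * w p) x1 G h1 h2 G0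
    (cont_on_measurable oU rU cg).
  move=> H; have /H : forall p, sq r p -> `|p.1 ^+ k * w p| <= G * p.1 ^+ a.
    move=> p pr; have [x_ge0 x_le1] := fst_bounds pr.
    rewrite normrM mulrC ler_pM ?HG// ger0_norm ?exprn_ge0//.
    exact: ler_wiXn2l.
  apply: eq_integrable; first exact: measurable_sq.
  by move=> p /set_mem pr /=; rewrite polyT_Xn.
- apply: (integrable_sq_rpw_pos (ltW r0) h4 _ _ _ HG') => //.
  + exact: cont_on_measurable ct.
  + exact: cont_on_measurable cg.
  + by move=> p pr; apply: le_trans (HT p pr); exact: ler_norm.
Qed.

(** Each integration by parts raises [k] by one and produces one factor [a s + k + 1]. It costs one
    [x]-derivative of the amplitude, and the two new amplitudes [w'] and [vx / v * w] again vanish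
    near the edge. *)
Lemma zetaJ_continuation N k w vx : xderiv U v vx -> xsmooth U N v -> xsmooth U N vx ->
  xsmooth U N w -> vanish_at_edge r w -> (a <= k + N)%N ->
  exists Q : R[i] -> R[i],
    (forall z : R[i], - m%:R^-1 < Re z -> slope_derivable Q z) /\
    (forall s : R[i], 0 < Re s ->
      (\prod_(i < N) (a%:R * s + (k + i).+1%:R)) * zetaJ a m r v k w s = Q s).
Proof.
move=> dv; have cvx := fun n => @xsmooth_cont _ U n vx.
elim: N k w => [|N IH] k w sv svx sw vw.
  rewrite addn0 => ak; exists (zetaJ a m r v k w); split.
    by move=> z; apply: zetaJ_slope => //; exact: xsmooth_cont sw.
  by move=> s _; rewrite big_ord0 mul1r.
rewrite addnS -addSn => ak.
have sv' := xsmoothW sv; have svx' := xsmoothW svx; have sw' := xsmoothW sw.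
case: (sw) => cw [w' [dw sw1]].
have vw' : vanish_at_edge r w' by exact: vanish_at_edge_deriv dw vw.
have sqw : xsmooth U N (fun p => vx p / v p * w p).
  apply: xsmoothM => //; apply: xsmoothM => //.
  by apply: xsmoothV => // p Up; rewrite gt_eqF// v_gt0.
have vqw : vanish_at_edge r (fun p => vx p / v p * w p).
  by move=> y yr; apply: filterS (vw y yr) => x ->; rewrite mulr0.
have [Q1 [sQ1 Q1E]] := IH k.+1 w' sv' svx' sw1 vw' ak.
have [Q2 [sQ2 Q2E]] := IH k.+1 _ sv' svx' sqw vqw ak.
exists (fun s => -1 * (Q1 s + s * Q2 s)); split.
  move=> z hz; apply: slope_derivableM; first exact: slope_derivable_cst.
  apply: slope_derivableD; first exact: sQ1.
  by apply: slope_derivableM; [exact: slope_derivable_id|exact: sQ2].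
move=> s s0; rewrite big_ord_recl addn0.
under eq_bigr do rewrite /bump/= addnS -addSn.
rewrite -Q1E// -Q2E//.
rewrite mulrAC (@zetaJ_parts _ a m r U v vx m_gt0 r0 oU rU v_gt0 cv (cvx _ svx) dv k w w' s
  s0 cw (xsmooth_cont sw1) dw vw).
by ring.
Qed.

(** * The difference between [|P|] and its model [y^m] *)

Section FlatPerturbation.
Variable e : 'I_m -> R -> R.
Hypothesis ce : forall i, cont_on U (fun p => e i p.1).
Hypothesis fe : forall K : nat, exists2 C : R, 0 <= C &
  forall i x, 0 <= x <= r -> `|e i x| <= C * x ^+ K.

Definition pertP (x : R) : {poly R} :=
  'X^m + \sum_(i < m) e i x *: 'X^(m - i.+1).

Let tail x : {poly R} := \sum_(i < m) e i x *: 'X^(m - i.+1).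

Let size_tail x : (size (tail x) < m.+1)%N.
Proof.
rewrite ltnS; apply: leq_trans (size_sum _ _ _) _; apply/bigmax_leqP => i _.
apply: leq_trans (size_scale_leq _ _) _; rewrite size_polyXn.
by rewrite subnSK// leq_subr.
Qed.

Lemma pertP_monic x : pertP x \is monic.
Proof.
rewrite monicE /pertP lead_coefDl; first by rewrite lead_coefXn.
by rewrite size_polyXn; exact: size_tail.
Qed.

Lemma size_pertP x : size (pertP x) = m.+1.
Proof. by rewrite /pertP size_polyDl size_polyXn//; exact: size_tail. Qed.

Lemma horner_pertP x y :
  (pertP x).[y] = y ^+ m + \sum_(i < m) e i x * y ^+ (m - i.+1).
Proof.
rewrite /pertP hornerD hornerXn horner_sum; congr (_ + _).
by apply: eq_bigr => i _; rewrite hornerZ hornerXn.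
Qed.

Lemma cont_on_sum (I : Type) (s : seq I) (F : I -> R * R -> R) :
  (forall i, cont_on U (F i)) -> cont_on U (fun p => \sum_(i <- s) F i p).
Proof.
move=> cF; elim: s => [|i s IH].
  have -> : (fun p => \sum_(i <- [::]) F i p) = (fun=> 0).
    by apply/funext => p; rewrite big_nil.
  by move=> p _; exact: cst_continuous.
have -> : (fun p => \sum_(j <- i :: s) F j p) = (fun p => F i p + \sum_(j <- s) F j p).
  by apply/funext => p; rewrite big_cons.
by move=> p Up; apply: cvgD; [exact: cF|exact: IH].
Qed.

Lemma cont_on_pertP : cont_on U (fun p => (pertP p.1).[p.2]).
Proof.
have -> : (fun p : R * R => (pertP p.1).[p.2]) =
    (fun p => p.2 ^+ m + \sum_(i < m) e i p.1 * p.2 ^+ (m - i.+1)).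
  by apply/funext => p; rewrite horner_pertP.
move=> p Up; apply: cvgD; first exact: (@cont_on_sndX R U m p Up).
apply: (@cont_on_sum _ _ (fun i p => e i p.1 * p.2 ^+ (m - i.+1)) _ p Up) => i.
by apply: cont_on_mul => //; exact: cont_on_sndX.
Qed.

Lemma cont_on_polyT (P : R -> {poly R}) : cont_on U (fun p => (P p.1).[p.2]) ->
  cont_on U (polyT P).
Proof.
move=> cP; apply: cont_on_mul => //; apply: cont_on_mul; first exact: cont_on_fstX.
move=> p Up; apply: (@continuous_comp _ _ _ (fun p : R * R => (P p.1).[p.2])
  (fun t => `|t|)); first exact: cP.
exact: norm_continuous.
Qed.

Lemma ln1D_le (x : R) : `|x| <= 2^-1 -> `|ln (1 + x)| <= 2 * `|x|.
Proof.
move=> x2; have [x1 x1'] : -1 < x /\ 0 < 1 + x.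
  by move: x2; rewrite ler_norml => /andP[? ?]; split; lra.
have h1 := le_ln1Dx x1.
have h2 : - ln (1 + x) <= 2 * `|x|.
  have y1 : -1 < - x / (1 + x).
    by rewrite ltr_pdivlMr//; lra.
  have -> : - ln (1 + x) = ln (1 + - x / (1 + x)).
    by rewrite -lnV//; congr ln; field; rewrite gt_eqF.
  apply: le_trans (le_ln1Dx y1) _; rewrite ler_pdivrMr//.
  have := ler_norm (- x); rewrite normrN => nx.
  have : 0 <= `|x| * (1 + 2 * x).
    rewrite mulr_ge0//; move: x2; rewrite ler_norml => /andP[? ?]; lra.
  by lra.
rewrite ler_norml; apply/andP; split; first by lra.
by apply: le_trans h1 _; have := ler_norm x; have := normr_ge0 x; lra.
Qed.

(** For [y > B x^M] one writes [P = y^m (1 + h)], where [h] is a sum of terms [eps_i / y^i];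
    flatness of [eps_i] outweighs the division by at most [y^m] and leaves a factor [x^a]. *)
Lemma pertP_close (M : nat) : exists2 B : R, 0 < B &
  forall x y, 0 < x -> x <= r -> B * x ^+ M < y ->
    [/\ 0 < `|(pertP x).[y]|, 0 < y &
      `|ln `|(pertP x).[y]| - ln (y ^+ m)| <= x ^+ a].
Proof.
(* The exponent [M * m] pays for the division by [y ^+ i.+1], and [a] is the gain. *)
have [C C0 HC] := fe (M * m + a).
(* [B >= 1] gives [B <= B ^+ i.+1], and [m C / B <= 1 / 2] brings [|h|] into the range of
   [ln1D_le]. *)
pose B : R := 1 + 2 * m%:R * C.
have B1 : 1 <= B by rewrite lerDl !mulr_ge0.
exists B; first exact: lt_le_trans ltr01 B1.
move=> x y x0 xr By.
have xle1 : x <= 1 by exact: le_trans r1.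
have B0 : 0 < B by exact: lt_le_trans ltr01 B1.
have y0 : 0 < y by apply: lt_trans By; rewrite mulr_gt0// exprn_gt0.
pose h := \sum_(i < m) e i x / y ^+ i.+1.
have PE : (pertP x).[y] = y ^+ m * (1 + h).
  rewrite horner_pertP mulrDr mulr1 mulr_sumr; congr (_ + _); apply: eq_bigr => i _.
  have -> : y ^+ m = y ^+ (m - i.+1) * y ^+ i.+1 by rewrite -exprD subnK.
  by field; rewrite expf_neq0// gt_eqF.
have hle : `|h| <= 2^-1 * x ^+ a.
  apply: le_trans (ler_norm_sum _ _ _) _.
  have bi (i : 'I_m) : `|e i x / y ^+ i.+1| <= C / B * x ^+ a.
    rewrite normrM normfV (ger0_norm (exprn_ge0 _ (ltW y0))).
    rewrite ler_pdivrMr ?exprn_gt0//.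
    apply: le_trans (HC i x _) _; first by rewrite ltW.
    have xa : 0 <= x ^+ a by rewrite exprn_ge0// ltW.
    have yM : B * x ^+ (M * m) <= y ^+ i.+1.
      apply: (@le_trans _ _ ((B * x ^+ M) ^+ i.+1)); last first.
        by rewrite lerXn2r ?nnegrE ?ltW// mulr_gt0// exprn_gt0.
      rewrite exprMn -exprM; apply: ler_pM.
      - exact: ltW.
      - by rewrite exprn_ge0// ltW.
      - by rewrite exprS ler_peMr ?exprn_ege1// ltW.
      - by apply: ler_wiXn2l => //; [exact: ltW|rewrite leq_mul2l ltn_ord orbT].
    rewrite exprD [leRHS](_ : _ = C / B * y ^+ i.+1 * x ^+ a); last by ring.
    rewrite mulrA ler_wpM2r// -mulrA ler_wpM2l// -ler_pdivrMl ?invr_gt0//.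
    by rewrite invrK.
  apply: (@le_trans _ _ (\sum_(i < m) C / B * x ^+ a)); first exact: ler_sum.
  have -> : \sum_(i < m) C / B * x ^+ a = m%:R * (C / B) * x ^+ a.
    by rewrite sumr_const card_ord -[LHS]mulr_natl mulrA.
  apply: ler_wpM2r; first by rewrite exprn_ge0// ltW.
  by rewrite mulrA ler_pdivrMr// /B; lra.
have xa1 : x ^+ a <= 1 by rewrite exprn_ile1// ltW.
have h2 : `|h| <= 2^-1 by apply: le_trans hle _; lra.
have h1 : 0 < 1 + h by move: h2; rewrite ler_norml => /andP[? ?]; lra.
have ym : 0 < y ^+ m by rewrite exprn_gt0.
rewrite PE normrM (gtr0_norm ym) (gtr0_norm h1) mulr_gt0//; split => //.
rewrite lnM// addrC addKr; apply: le_trans (ln1D_le h2) _; lra.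
Qed.

(** The amplitude is cut by the indicator [far] into [gA] and [gB]. Against [gA] the difference of
    the powers is integrated as a whole; against [gB] the two powers are integrated separately. *)
Lemma pertP_near_derivable b w (z : R[i]) : cont_on U w -> - m%:R^-1 < Re z ->
  cderivable (fun s => cint lebesgue2 (sq r) (fun p =>
    (cpw (polyT pertP p) s - cpw (polyT (fun=> 'X^m) p) s) * (p.1 ^+ b * w p)%:C)) z.
Proof.
move=> cw hz; have [x1 [x2 [h1 h2 h3 h4 h5]]] := strip_exponents hz.
have m0 : 0 < m%:R :> R by rewrite ltr0n.
have mx1 : 0 < 1 + m%:R * x1.
  by move: h1; rewrite -(ltr_pM2l m0) mulrN divff ?gt_eqF//; lra.
(* The gain from a region of width [x^M] must compensate [x^(-a)]; this is possible since
   [1 + m x1 > 0]. *)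
have [M HM] : exists M : nat, a%:R <= M%:R * (1 + m%:R * x1).
  exists (Num.truncn (a%:R / (1 + m%:R * x1))).+1; rewrite -ler_pdivrMr//.
  by have /andP[_ /ltW] := truncn_itv (divr_ge0 (ler0n R a) (ltW mx1)).
have [B B0 HB] := pertP_close M.
pose t1 := polyT pertP; pose t2 := polyT (fun=> 'X^m).
have ct1 : cont_on U t1 by apply: cont_on_polyT; exact: cont_on_pertP.
have ct2 : cont_on U t2.
  apply: cont_on_polyT; have -> : (fun p : R * R => ('X^m : {poly R}).[p.2]) = (fun p => p.2 ^+ m).
    by apply/funext => q; rewrite hornerXn.
  exact: cont_on_sndX.
have cg : cont_on U (fun p => p.1 ^+ b * w p).
  by apply: cont_on_mul => //; exact: cont_on_fstX.
pose g p := p.1 ^+ b * w p.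
have mg := cont_on_measurable oU rU cg.
have mt1 := cont_on_measurable oU rU ct1.
have mt2 := cont_on_measurable oU rU ct2.
have mD := @measurable_sq R r.
have [G G0 HG] := continuous_sq_bounded rU cg.
have [T1 _ HT1] := continuous_sq_bounded rU ct1.
have [T2 _ HT2] := continuous_sq_bounded rU ct2.
(* The edge [x = 0] is left to [gB]; there [polyT] is 0 and so are its powers. *)
pose far (p : plane) : R := (if 0 < p.1 then 1 else 0) *
  (if B * p.1 ^+ M < p.2 then 1 else 0).
have farE p : far p = if (0 < p.1) && (B * p.1 ^+ M < p.2) then 1 else 0.
  by rewrite /far; case: ifP => _; case: ifP => _; rewrite ?mulr0 ?mul0r ?mulr1.
have mfar : measurable_fun (sq r : set plane) far.
  apply: measurable_funTS; apply: measurable_funM.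
    apply: measurable_fun_ifT => //; apply: measurable_fun_ltr => //.
  apply: measurable_fun_ifT => //; apply: measurable_fun_ltr => //.
  apply: measurable_funM => //; exact: measurable_funX.
pose gA p := far p * g p; pose gB p := (1 - far p) * g p.
have mgA : measurable_fun (sq r : set plane) (gA : plane -> R) by exact: measurable_funM.
have mgB : measurable_fun (sq r : set plane) (gB : plane -> R).
  by apply: measurable_funM => //; exact: measurable_funB.
have gAle p : sq r p -> `|gA p| <= G.
  move=> pr; rewrite /gA farE; case: ifP => _; first by rewrite mul1r HG.
  by rewrite mul0r normr0.
have gBle p : sq r p -> `|gB p| <= G.
  move=> pr; rewrite /gB farE; case: ifP => _; last by rewrite subr0 mul1r HG.
  by rewrite subrr mul0r normr0.
have gB0 p : sq r p -> 0 < p.1 -> gB p != 0 -> p.2 <= B * p.1 ^+ M.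
  move=> pr p0; rewrite /gB farE p0/= => /eqP; rewrite leNgt => gp.
  by apply/negP => Bp; apply: gp; rewrite Bp subrr mul0r.
have close p : sq r p -> gA p != 0 ->
    [/\ 0 < t1 p, 0 < t2 p & `|ln (t1 p) - ln (t2 p)| <= p.1 ^+ a].
  move=> pr; rewrite /gA farE; case: ifP => [/andP[p0 Bp] _|_]; last by rewrite mul0r eqxx.
  have /sqP[/andP[_ xr] _] := pr.
  have [P0 y0 Hl] := HB _ _ p0 xr Bp.
  have vp := v_gt0 (rU pr); have xa : 0 < p.1 ^+ a by rewrite exprn_gt0.
  have ym : 0 < p.2 ^+ m by rewrite exprn_gt0.
  rewrite /t1 /t2 /polyT hornerXn (gtr0_norm ym); split; rewrite ?mulr_gt0//.
  rewrite !lnM ?posrE ?mulr_gt0//.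
  by rewrite (_ : _ - _ = ln `|(pertP p.1).[p.2]| - ln (p.2 ^+ m)); last by ring.
have fb p : sq r p -> 0 <= p.1 ^+ a <= 1.
  by move=> /fst_bounds[? ?]; rewrite exprn_ge0//= exprn_ile1.
pose la p := ln (t1 p) - ln (t2 p).
have mla : measurable_fun (sq r : set plane) (fun p => la p * gA p).
  apply: measurable_funM => //; apply: measurable_funB.
    exact: measurableT_comp (@measurable_ln R) mt1.
  exact: measurableT_comp (@measurable_ln R) mt2.
have lale p : sq r p -> `|la p * gA p| <= G * p.1 ^+ a.
  move=> pr; have [->|g0] := eqVneq (gA p) 0.
    by rewrite mulr0 normr0 mulr_ge0//; case/andP: (fb p pr).
  have [_ _ hl] := close p pr g0.
  by rewrite normrM mulrC ler_pM// gAle.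
have lale' p : sq r p -> `|la p * gA p| <= G.
  move=> pr; apply: le_trans (lale p pr) _; rewrite ler_piMr//.
  by case/andP: (fb p pr).
have iA1 : lebesgue2.-integrable (sq r) (EFin \o (fun p => rpw (t2 p) x1 * `|la p * gA p|)).
  exact: (@integrable_polyT_monomial (fun p => la p * gA p) x1 G).
have iA2 : lebesgue2.-integrable (sq r) (EFin \o (fun p => rpw (t2 p) x2 * `|la p * gA p|)).
  apply: (integrable_sq_rpw_pos (ltW r0) h4 _ _ _ lale') => //.
  by move=> p pr; apply: le_trans (HT2 p pr); exact: ler_norm.
have KA s : x1 < Re s -> Re s < x2 ->
    cinte lebesgue2 (sq r) (fun p => (cpw (t1 p) s - cpw (t2 p) s) * (gA p)%:C) /\
    cderivable (fun s => cint lebesgue2 (sq r)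
      (fun p => (cpw (t1 p) s - cpw (t2 p) s) * (gA p)%:C)) s.
  move=> hs1 hs2; apply: (@cint_powerB_derivable _ _ _ lebesgue2 _ mD t1 t2 gA x1 x2) => //.
  move=> p pr g0; have [? ? hl] := close p pr g0; split => //.
  by apply: le_trans hl _; case/andP: (fb p pr).
have KB P : (forall x, P x \is monic) -> (forall x, size (P x) = m.+1) ->
    cont_on U (polyT P) -> forall s, x1 < Re s -> Re s < x2 ->
    cinte lebesgue2 (sq r) (fun p => cpw (polyT P p) s * (gB p)%:C) /\
    cderivable (fun s => cint lebesgue2 (sq r) (fun p => cpw (polyT P p) s * (gB p)%:C)) s.
  move=> mP sP cP s hs1 hs2; have mtP := cont_on_measurable oU rU cP.
  have [T _ HT] := continuous_sq_bounded rU cP.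
  have i1 := @integrable_polyT_flat P M gB x1 B G h1 h2 B0 HM mP sP mtP mgB gBle gB0.
  have i2 : lebesgue2.-integrable (sq r) (EFin \o (fun p => rpw (polyT P p) x2 * `|gB p|)).
    apply: (integrable_sq_rpw_pos (ltW r0) h4 _ _ _ gBle) => //.
    by move=> p pr; apply: le_trans (HT p pr); exact: ler_norm.
  split; first by apply: (@cinte_power _ _ _ lebesgue2 _ mD _ _ x1 x2) => //; exact: ltW.
  by apply: slope_derivable_derivable; apply: (@cint_power_slope _ _ _ lebesgue2 _ mD _ _ x1 x2).
have KB1 := KB _ pertP_monic size_pertP ct1.
have KB2 := KB (fun=> 'X^m) (fun _ => monicXn _ m) (fun _ => size_polyXn _ m) ct2.
pose DA s := cint lebesgue2 (sq r) (fun p => (cpw (t1 p) s - cpw (t2 p) s) * (gA p)%:C).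
pose D1 s := cint lebesgue2 (sq r) (fun p => cpw (t1 p) s * (gB p)%:C).
pose D2 s := cint lebesgue2 (sq r) (fun p => cpw (t2 p) s * (gB p)%:C).
have E s : x1 < Re s -> Re s < x2 -> DA s + (D1 s + -1 * D2 s) =
    cint lebesgue2 (sq r) (fun p => (cpw (t1 p) s - cpw (t2 p) s) * (p.1 ^+ b * w p)%:C).
  move=> hs1 hs2; have [ia _] := KA s hs1 hs2.
  have [ib _] := KB1 s hs1 hs2; have [ic _] := KB2 s hs1 hs2.
  rewrite /DA /D1 /D2 -cintZ// -cintD//; last exact: cinteZ.
  rewrite -cintD//; last by apply: cinteD => //; exact: cinteZ.
  apply: eq_cint => p _; rewrite /gA /gB -/(g p) -/t1 -/t2.
  move: (far p) (g p) => f0 g0.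
  by rewrite !(rmorphM, rmorphB, rmorph1)/=; ring.
have dE : cderivable (fun s => DA s + (D1 s + -1 * D2 s)) z.
  apply: derivable_add; first exact: (KA z h3 h5).2.
  apply: derivable_add; first exact: (KB1 z h3 h5).2.
  by apply: derivable_mul; [exact: derivable_cst|exact: (KB2 z h3 h5).2].
(* The decomposition holds only where [x1 < Re s < x2], that is, near [z]; [M] and the cut depend on
   this strip. *)
apply: cderivable_near_eq dE; apply/near_at_nrm.
exists (Num.min (Re z - x1) (x2 - Re z)); first by rewrite lt_min !subr_gt0 h3.
move=> s; rewrite lt_min => /andP[s1 s2].
have := Re_le_nrm (s - z); rewrite ReD ReN ler_norml => /andP[? ?].
by apply: E; lra.
Qed.

End FlatPerturbation.

End LocalZetaParts.

(** * The local zeta function *)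

Section Restriction.
Context {R : realType}.
Local Notation plane := (measurableTypeR R * measurableTypeR R)%type.

Lemma measurable_quadrant : measurable (quadrant : set plane).
Proof.
have -> : quadrant = `[0, +oo[%classic `*` `[0, +oo[%classic :> set (R * R).
  by apply/seteqP; split => p /=; rewrite !in_itv/= !andbT.
by apply: measurableX; exact: measurable_itv.
Qed.

Lemma quadrant_sq (r : R) (f : plane -> R) :
  (forall p, quadrant p -> f p != 0 -> sq r p) ->
  (f \_ (quadrant : set plane)) = (f \_ (sq r : set plane)).
Proof.
move=> fr; apply/funext => p; rewrite !patchE.
have [pq|pq] := pselect (quadrant p); last first.
  rewrite memNset// memNset// => /sqP[/andP[p1 _] /andP[p2 _]].
  exact: pq.
rewrite mem_set//; have [ps|ps] := pselect (sq r p); first by rewrite mem_set.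
by rewrite memNset//; apply/eqP/negPn/negP => fp; apply: ps; exact: fr.
Qed.

Lemma cint_quadrant_sq (r : R) (F : plane -> R[i]) :
  (forall p, quadrant p -> F p != 0 -> sq r p) ->
  cint lebesgue2 quadrant F = cint lebesgue2 (sq r) F /\
  (cinte lebesgue2 (sq r) F -> cinte lebesgue2 quadrant F).
Proof.
move=> Fr.
have r1 p : quadrant p -> Re (F p) != 0 -> sq r p.
  by move=> pq Fp; apply: Fr => //; apply: contra_neq Fp => ->.
have r2 p : quadrant p -> Im (F p) != 0 -> sq r p.
  by move=> pq Fp; apply: Fr => //; apply: contra_neq Fp => ->.
have e1 := quadrant_sq r1; have e2 := quadrant_sq r2.
split.
  apply: complexP; rewrite /cint/= Rintegral_mkcond [RHS]Rintegral_mkcond.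
    by rewrite e1.
  by rewrite e2.
have mq := measurable_quadrant; have ms := @measurable_sq R r.
have rE (f : plane -> R) (A : set plane) : ((fun p : plane => (f p)%:E) \_ A) = EFin \o (f \_ A).
  exact: restrict_EFin.
move=> [i1 i2]; split; apply/(integrable_mkcond _ mq).
  move: i1 => /(integrable_mkcond _ ms).
  by rewrite (rE (fun p => Re (F p)) (sq r)) (rE (fun p => Re (F p)) quadrant) e1.
move: i2 => /(integrable_mkcond _ ms).
by rewrite (rE (fun p => Im (F p)) (sq r)) (rE (fun p => Im (F p)) quadrant) e2.
Qed.

End Restriction.

Section RealAmplitude.
Context {R : realType}.
Variables (a m b : nat) (r c0 : R) (U : set (R * R)) (v vx : R * R -> R).
Hypotheses (a_gt0 : (0 < a)%N) (m_gt0 : (0 < m)%N).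
Hypotheses (r0 : 0 < r) (r1 : r <= 1) (oU : open U) (rU : sq r `<=` U).
Hypotheses (c00 : 0 < c0) (v0 : forall p, U p -> c0 <= v p).
Hypotheses (sv : xsmooth U a v) (dv : xderiv U v vx) (svx : xsmooth U a vx).
Variable e : 'I_m -> R -> R.
Hypothesis ce : forall i, cont_on U (fun p => e i p.1).
Hypothesis fe : forall K : nat, exists2 C : R, 0 <= C &
  forall i x, 0 <= x <= r -> `|e i x| <= C * x ^+ K.
Variable w : R * R -> R.
Hypotheses (sw : xsmooth U a w) (vw : vanish_at_edge r w).

Let cv := xsmooth_cont sv.
Let cw := xsmooth_cont sw.
Let mD := @measurable_sq R r.
Let cg : cont_on U (fun p => p.1 ^+ b * w p).
Proof. by apply: cont_on_mul => //; exact: cont_on_fstX. Qed.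
Let cT : cont_on U (polyT a v (pertP e)).
Proof. by apply: cont_on_polyT => //; exact: cont_on_pertP. Qed.

Definition zetaI (s : R[i]) : R[i] := cint lebesgue2 (sq r)
  (fun p => cpw (polyT a v (pertP e) p) s * (p.1 ^+ b * w p)%:C).

Let integrable_zetaI (x : R) : 0 <= x -> lebesgue2.-integrable (sq r)
  (EFin \o (fun p => rpw (polyT a v (pertP e) p) x * `|p.1 ^+ b * w p|)).
Proof.
move=> x0; have [T _ HT] := continuous_sq_bounded rU cT.
have [G _ HG] := continuous_sq_bounded rU cg.
apply: (integrable_sq_rpw_pos (ltW r0) x0 _ _ _ HG).
- exact: cont_on_measurable cT.
- exact: cont_on_measurable cg.
- by move=> p pr; apply: le_trans (HT p pr); exact: ler_norm.
Qed.

Lemma cinte_zetaI (s : R[i]) : 0 < Re s -> cinte lebesgue2 (sq r)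
  (fun p => cpw (polyT a v (pertP e) p) s * (p.1 ^+ b * w p)%:C).
Proof.
move=> s0; apply: (@cinte_power _ _ _ lebesgue2 _ mD _ _ (Re s) (Re s)) => //.
- exact: cont_on_measurable cT.
- exact: cont_on_measurable cg.
- by apply: integrable_zetaI; exact: ltW.
- by apply: integrable_zetaI; exact: ltW.
Qed.

Lemma zetaI_derivable (s : R[i]) : 0 < Re s -> cderivable zetaI s.
Proof.
move=> s0; apply: slope_derivable_derivable.
apply: (@cint_power_slope _ _ _ lebesgue2 _ mD _ _ 0 (Re s + 1)) => //.
- exact: cont_on_measurable cT.
- exact: cont_on_measurable cg.
- by apply: integrable_zetaI.
- by apply: integrable_zetaI; lra.
- by rewrite ltrDl.
Qed.

(** For [Re s > 0] both integrals converge and [zetaI - D] is the monomial integral [zetaJ]. The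
    identity is kept multiplied out, since the division belongs to [meromorphic_quotient]. *)
Lemma zetaI_continuation : exists Q D : R[i] -> R[i],
  [/\ forall z : R[i], - m%:R^-1 < Re z -> slope_derivable Q z,
    forall z : R[i], - m%:R^-1 < Re z -> cderivable D z &
    forall s : R[i], 0 < Re s ->
      (\prod_(i < a) (a%:R * s + (b + i).+1%:R)) * (zetaI s - D s) = Q s].
Proof.
have [Q [sQ QE]] := zetaJ_continuation a_gt0 m_gt0 r0 r1 oU rU c00 v0 cv dv sv
  svx sw vw (leq_addl b a).
exists Q, (fun s => cint lebesgue2 (sq r) (fun p =>
  (cpw (polyT a v (pertP e) p) s - cpw (polyT a v (fun=> 'X^m) p) s) *
  (p.1 ^+ b * w p)%:C)); split => //.
  by move=> z hz; apply: (@pertP_near_derivable _ a m r c0 U v).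
move=> s s0; rewrite -QE//; congr (_ * _).
have v_gt0 p : U p -> 0 < v p by move=> /v0; exact: lt_le_trans.
have iI := cinte_zetaI s0.
have iJ := @cinte_zetaJ R a m r U v r0 oU rU cv b w s s0 cw.
have -> : cint lebesgue2 (sq r) (fun p =>
    (cpw (polyT a v (pertP e) p) s - cpw (polyT a v (fun=> 'X^m) p) s) *
    (p.1 ^+ b * w p)%:C) = zetaI s + -1 * zetaJ a m r v b w s.
  rewrite /zetaI /zetaJ -cintZ// -cintD//; last exact: cinteZ.
  apply: eq_cint => p /set_mem pr; rewrite (@polyT_Xn R a m r v p pr).
  by ring.
by ring.
Qed.

End RealAmplitude.

(** * Choice of the square and of the amplitude data *)

Section Setup.
Context {R : realType}.

(** Near the origin [u] keeps its sign, so [|u|] is [u] times a constant sign and is as smooth as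
    [u]; the lower bound [|u(0,0)| / 2] holds where [u] differs from [u(0,0)] by less than that. *)
Lemma local_data (a m : nat) (u : R * R -> R) (eps : 'I_m -> R -> R) :
  smooth_near_origin u -> u (0, 0) != 0 ->
  (forall i, smooth_near0 (eps i)) -> (forall i, flat_at0 (eps i)) ->
  exists (r c0 : R) (U : set (R * R)) (v vx : R * R -> R),
    [/\ [/\ 0 < r, r <= 1, open U & sq r `<=` U],
      [/\ 0 < c0, forall p, U p -> c0 <= v p & forall p, U p -> `|u p| = v p],
      [/\ xsmooth U a v, xderiv U v vx & xsmooth U a vx],
      forall i, cont_on U (fun p => eps i p.1) &
      forall K : nat, exists2 C : R, 0 <= C &
        forall i x, 0 <= x <= r -> `|eps i x| <= C * x ^+ K].
Proof.
move=> [U0 [oU0 U00 su]] u0 se fe.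
have [rho /= rho0 Hrho] : exists2 d : R, 0 < d & forall x, `|x| < d ->
    forall i n, derivable (derive1n n (eps i)) x 1.
  have : \forall x \near (0 : R), forall i n, derivable (derive1n n (eps i)) x 1.
    have := @filter_forall R 'I_m
      (fun i x => forall n, derivable (derive1n n (eps i)) x 1) (nbhs (0 : R)) _ se.
    exact.
  move=> /nbhs_ballP[d /= d0 Hd]; exists d => // x xd; apply: Hd.
  by rewrite -ball_normE/= sub0r normrN.
pose h := `|u (0, 0)| / 2; have h0 : 0 < h by rewrite divr_gt0// normr_gt0.
pose U : set (R * R) := [set p | [/\ U0 p, `|u p - u (0, 0)| < h & `|p.1| < rho]].
have cu p : U0 p -> {for p, continuous u} by move=> Up; exact: (su [::] p Up).1.
have oU : open U.
  rewrite openE => p [Up hp rp].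
  have n1 := open_nbhs_nbhs (conj oU0 Up).
  have n2 : \forall q \near p, `|u q - u (0, 0)| < h.
    have c2 : {for p, continuous (fun q => `|u q - u (0, 0)|)}.
      apply: (@continuous_comp _ _ _ (fun q => u q - u (0, 0)) (fun t => `|t|)).
        by apply: cvgB; [exact: cu|exact: cst_continuous].
      exact: norm_continuous.
    exact: (cvgr_lt _ c2 _ hp).
  have n3 : \forall q \near p, `|q.1| < rho.
    have c3 : {for p, continuous (fun q : R * R => `|q.1|)}.
      apply: (@continuous_comp _ _ _ (fun q : R * R => q.1) (fun t : R => `|t|));
        first exact: cvg_fst.
      exact: norm_continuous.
    exact: (cvgr_lt _ c3 _ rp).
  by apply: filterS3 n1 n2 n3 => q.
have U_0 : U (0, 0) by split => //; rewrite ?subrr normr0.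
have /nbhs_ballP[d /= d0 dU] := open_nbhs_nbhs (conj oU U_0).
pose r := Num.min 1 (d / 2).
have r0 : 0 < r by rewrite lt_min ltr01 divr_gt0.
have r1 : r <= 1 by rewrite ge_min lexx.
have rd : r < d.
  by apply: (@le_lt_trans _ _ (d / 2)); [rewrite ge_min lexx orbT|lra].
have rU : sq r `<=` U.
  move=> p /sqP[/andP[p1 p1r] /andP[p2 p2r]]; apply: dU; split => /=.
    by rewrite -ball_normE/= sub0r normrN ger0_norm//; exact: le_lt_trans rd.
  by rewrite -ball_normE/= sub0r normrN ger0_norm//; exact: le_lt_trans rd.
pose sg := Num.sg (u (0, 0)); pose v p := sg * u p.
have v_ge p : U p -> h <= v p.
  move=> [_ hp _]; have -> : v p = `|u (0, 0)| + sg * (u p - u (0, 0)).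
    by rewrite /v /sg normrEsg; ring.
  have : `|sg * (u p - u (0, 0))| < h by rewrite normrM normr_sg u0 mul1r.
  by rewrite ltr_norml /h => /andP[? _]; lra.
have sU : smooth_on U u by move=> ds p [Up _ _]; exact: su.
have sv n : xsmooth U n v.
  by apply: xsmoothM; [exact: xsmooth_cst|exact: smooth_on_xsmooth].
(* One order more than [a], so that [vx] itself still has [a] derivatives in [x]. *)
have [_ [vx [dv svx]]] := sv a.+1.
exists r, h, U, v, vx; split => //.
- split => // p Up; have vp := lt_le_trans h0 (v_ge p Up).
  by rewrite -(gtr0_norm vp) /v normrM normr_sg u0 mul1r.
- move=> i p [_ _ rp]; apply: (@continuous_comp _ _ _ fst (eps i)).
    exact: cvg_fst.
  by apply/differentiable_continuous/derivable1_diffP; exact: (Hrho _ rp i 0%N).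
move=> K.
have /choice[C HC] : forall i, exists C : R, 0 <= C /\
    forall x, 0 <= x <= r -> `|eps i x| <= C * x ^+ K.
  move=> i; have de x : 0 <= x <= r -> forall n, derivable (derive1n n (eps i)) x 1.
    move=> xr n; apply: Hrho.
    have Ux : U (x, 0) by apply: rU; apply/sqP; split => //=; rewrite lexx ltW.
    by case: Ux.
  have [C C0 HC] := @flat_le R (eps i) r K (ltW r0) de (fe i).
  by exists C.
exists (\sum_i C i); first by apply: sumr_ge0 => i _; case: (HC i).
move=> i x xr; have [_ Hi] := HC i; apply: le_trans (Hi x xr) _.
rewrite ler_wpM2r ?exprn_ge0//; first by case/andP: xr.
by rewrite (bigD1 i)//= lerDl sumr_ge0// => j _; case: (HC j).
Qed.

(** The ball of the plane is an open box, so the line [x = r] misses the support; the support being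
    closed, so does a neighbourhood of each point of that line. *)
Lemma test_function_edge (r : R) (phi : R * R -> R[i]) : 0 < r ->
  test_function (ball (0 : R * R) r) phi ->
  [/\ vanish_at_edge r (fun p => Re (phi p)),
      vanish_at_edge r (fun p => Im (phi p)) &
      forall p, quadrant p -> phi p != 0 -> sq r p].
Proof.
move=> r0 [_ _ _ sU].
have edge y : \forall x \near r, phi (x, y) = 0.
  have ry : ~ closure [set p | phi p != 0] (r, y).
    move=> /sU[/= + _]; rewrite -ball_normE/= sub0r normrN gtr0_norm//.
    by rewrite ltxx.
  have : nbhs ((r, y) : R * R) (~` closure [set p | phi p != 0]).
    by apply: open_nbhs_nbhs; split => //; apply: closed_openC; exact: closed_closure.
  move=> /(@continuous_pairl R r y) h.
  have h' : \forall x \near r, ~ closure [set p | phi p != 0] (x, y) by exact: h.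
  apply: filterS h' => x nx.
  by apply/eqP/negPn/negP => px; apply: nx; exact: subset_closure.
split.
- by move=> y _; apply: filterS (edge y) => x ->.
- by move=> y _; apply: filterS (edge y) => x ->.
move=> p [p1 p2] pp; have [] := sU p (subset_closure (pp : [set p | phi p != 0] p)).
rewrite -!ball_normE/= !sub0r !normrN !ger0_norm// => /ltW h1 /ltW h2.
by apply/sqP; rewrite p1 p2.
Qed.

Lemma near_halfplane (c : R) (z : R[i]) : halfplane c z -> near_at z (halfplane c).
Proof.
rewrite /halfplane/= => cz; apply/near_at_nrm; exists (Re z - c).
  by rewrite subr_gt0.
move=> w; have := Re_le_nrm (w - z); rewrite ReD ReN ler_norml => /andP[h _] wz /=.
by lra.
Qed.

End Setup.

Theorem theorem9p1 (R : realType) (a m : nat) (u : R * R -> R)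
    (eps : 'I_m -> R -> R)
    (a_gt0 : (0 < a)%N) (m_gt0 : (0 < m)%N)
    (u_smooth : smooth_near_origin u) (u_neq0 : u (0, 0) != 0)
    (eps_smooth : forall i : 'I_m, smooth_near0 (eps i))
    (eps_flat : forall i : 'I_m, flat_at0 (eps i)) :
  let G := modelG a u eps in
  exists2 U : set (R * R), nbhs (0 : R * R) U &
    forall (b : nat) (phi : R * R -> R[i]), test_function U phi ->
    [/\ (forall s : R[i], halfplane 0 s ->
           cintegrable quadrant (zeta_integrand G b phi s)),
        holomorphic_on (halfplane 0) (zeta G b phi) &
        exists Z : R[i] -> R[i],
          [/\ (forall s : R[i], halfplane 0 s -> Z s = zeta G b phi s),
              meromorphic_on (halfplane (- (m%:R)^-1)) Z &
              (0 < b)%N -> a%:R / b%:R <= m%:R :> R ->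
              forall s : R[i], halfplane (- (m%:R)^-1) s -> pole Z s ->
              exists2 j : nat, (0 < j)%N &
                s = (- ((b + j)%:R / a%:R))%:C]].
Proof.
move=> G.
have [r [c0 [U [v [vx [[r0 r1 oU rU] [c00 v0 uv] [sv dv svx] ce fe]]]]]] :=
  local_data a u_smooth u_neq0 eps_smooth eps_flat.
(* The radius is fixed before [b] and [phi] are given. *)
exists (ball (0 : R * R) r); first exact: nbhsx_ballx.
move=> b phi tphi.
have [vw1 vw2 phi0] := test_function_edge r0 tphi.
have [sphi1 sphi2 _ _] := tphi.
have sU f : smooth_on setT f -> xsmooth U a f.
  by move=> sf; apply: smooth_on_xsmooth => ds p _; exact: sf.
pose w1 p := Re (phi p); pose w2 p := Im (phi p).
have sw1 : xsmooth U a w1 by exact: sU.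
have sw2 : xsmooth U a w2 by exact: sU.
pose I1 := zetaI a b r v eps w1; pose I2 := zetaI a b r v eps w2.
pose K1 s p := cpw (polyT a v (pertP eps) p) s * (p.1 ^+ b * w1 p)%:C.
pose K2 s p := cpw (polyT a v (pertP eps) p) s * (p.1 ^+ b * w2 p)%:C.
have mD := @measurable_sq R r.
have i1 (s : R[i]) : 0 < Re s -> cinte lebesgue2 (sq r) (K1 s).
  by move=> s0; apply: (@cinte_zetaI R a m b r U v) => //.
have i2 (s : R[i]) : 0 < Re s -> cinte lebesgue2 (sq r) (K2 s).
  by move=> s0; apply: (@cinte_zetaI R a m b r U v) => //.
have KE (s : R[i]) p : 0 < Re s -> sq r p ->
    K1 s p + 'i%C * K2 s p = zeta_integrand G b phi s p.
  move=> s0 pr; have /sqP[/andP[x0 _] /andP[y0 _]] := pr.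
  have GE : `|G p| = polyT a v (pertP eps) p.
    rewrite /G /modelG /polyT horner_pertP !normrM (uv p (rU p pr)).
    by rewrite (ger0_norm (exprn_ge0 _ x0)); ring.
  (* At the zeros of [G] the kernels [cpowR] and [cpw] agree because [Re s != 0]. *)
  rewrite /zeta_integrand GE cpwE ?gt_eqF//; last by rewrite -GE.
  rewrite /K1 /K2 [in RHS](complexE (phi p)) -/(w1 p) -/(w2 p) !rmorphM/=.
  by ring.
have zr s p : quadrant p -> zeta_integrand G b phi s p != 0 -> sq r p.
  by move=> pq zp; apply: phi0 => //; apply: contra_neq zp => p0; rewrite /zeta_integrand p0 mulr0.
have iK (s : R[i]) : 0 < Re s ->
    cinte lebesgue2 (sq r) (zeta_integrand G b phi s).
  move=> s0; have := cinteD mD (i1 s s0) (cinteZ mD 'i%C (i2 s s0)).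
  by apply: (eq_cinte mD) => p /set_mem pr; exact: KE.
have zetaE (s : R[i]) : 0 < Re s -> zeta G b phi s = I1 s + 'i%C * I2 s.
  move=> s0; rewrite -[LHS]/(cint lebesgue2 quadrant (zeta_integrand G b phi s)).
  rewrite (cint_quadrant_sq (zr s)).1 /I1 /I2 /zetaI.
  have := i2 s s0; have := i1 s s0; rewrite /K1 /K2 => j1 j2.
  rewrite -cintZ// -cintD//; last exact: cinteZ.
  by apply: eq_cint => p /set_mem pr; rewrite -KE.
have [Q1 [D1 [sQ1 dD1 E1]]] := zetaI_continuation b a_gt0 m_gt0 r0 r1 oU rU c00
  v0 sv dv svx ce fe sw1 vw1.
have [Q2 [D2 [sQ2 dD2 E2]]] := zetaI_continuation b a_gt0 m_gt0 r0 r1 oU rU c00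
  v0 sv dv svx ce fe sw2 vw2.
split.
- move=> s s0; exact: (cint_quadrant_sq (zr s)).2 (iK s s0).
- move=> s s0; apply: holomorphic_near_at.
  have := near_halfplane s0; rewrite !near_at_nrm => -[d d0 Hd].
  exists (d / 2) => [|z zs]; first by rewrite divr_gt0.
  apply: (@cderivable_near_eq _ (fun s => I1 s + 'i%C * I2 s)).
    apply/near_at_nrm; exists (d / 2) => [|t tz]; first by rewrite divr_gt0.
    rewrite zetaE//; apply: Hd; rewrite (_ : t - s = (t - z) + (z - s)); last by ring.
    by apply: le_lt_trans (nrmD _ _) _; lra.
  have z0 : 0 < Re z by apply: Hd; lra.
  apply: derivable_add; first by apply: (@zetaI_derivable R a m b r U v).
  apply: derivable_mul; first exact: derivable_cst.
  by apply: (@zetaI_derivable R a m b r U v).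
(* The zeros of the [a] factors [a s + b + i + 1]; they are pairwise distinct, and [a ^+ a] in [Q]
   makes the factors monic. *)
pose root i : R[i] := (- ((b + i.+1)%:R / a%:R))%:C.
pose rs := [seq root i | i <- index_iota 0 a].
pose Q z := (Q1 z + 'i%C * Q2 z) * (a%:R ^+ a)^-1.
pose H z := D1 z + 'i%C * D2 z.
have aR : a%:R != 0 :> R by rewrite pnatr_eq0 -lt0n.
have aC : a%:R != 0 :> R[i] by rewrite pnatr_eq0 -lt0n.
have us : uniq rs.
  rewrite map_inj_uniq ?iota_uniq// => i j /complexI /oppr_inj /(mulIf (invr_neq0 aR)).
  by move=> /eqP; rewrite eqr_nat eqn_add2l eqSS => /eqP.
have prodE z : \prod_(i < a) (a%:R * z + (b + i).+1%:R) =
    a%:R ^+ a * \prod_(t <- rs) (z - t).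
  have -> : a%:R ^+ a = \prod_(i < a) (a%:R : R[i]) by rewrite prodr_const card_ord.
  rewrite big_map big_mkord -big_split/=.
  apply: eq_bigr => i _; rewrite /root rmorphN rmorphM fmorphV !rmorph_nat addnS.
  by field.
have oD := open_near_at (@near_halfplane R (- m%:R^-1)).
have sQ z : halfplane (- m%:R^-1) z -> slope_derivable Q z.
  move=> hz; apply: slope_derivableM; last exact: slope_derivable_cst.
  apply: slope_derivableD; first exact: sQ1.
  by apply: slope_derivableM; [exact: slope_derivable_cst|exact: sQ2].
have dH z : halfplane (- m%:R^-1) z -> cderivable H z.
  move=> hz; apply: derivable_add; first exact: dD1.
  by apply: derivable_mul; [exact: derivable_cst|exact: dD2].
have [Z [ZE mZ pZ]] := meromorphic_quotient oD us sQ dH.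
exists Z; split => //.
- move=> s s0.
  (* All the roots are real and nonpositive, so on [Re s > 0] the quotient is not affected by the
     modified values. *)
  have srs : s \notin rs.
    apply/mapP => -[i _ sE]; move: s0; rewrite /halfplane/= sE/= oppr_gt0.
    by rewrite ltNge divr_ge0.
  have P0 : \prod_(t <- rs) (s - t) != 0.
    rewrite prodf_seq_neq0; apply/allP => t tr /=.
    by rewrite subr_eq0; apply: contraNneq srs => ->.
  rewrite ZE// zetaE// /Q -E1// -E2// prodE /H -/I1 -/I2.
  by field; rewrite P0 expf_neq0.
- move=> _ _ s hs /(pZ s hs)/mapP[i _ ->]; by exists i.+1.
Qed.
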